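(* There is an absolute constant $C>0$ such that the following holds. Consider the distributed problem with $L$-Lipschitz gradients, the stochastic oracle with variance bound $\sigma^2$, and the SCAFFOLD algorithm with communication interval $\tau\ge2$, $2R$ communication rounds ($R\ge1$) and $T=2R\tau$ iterations, all as described in the context. Let $\Delta=f(\bar{\mathbf x}_0)-f^*>0$. Assume: (i) (standard Hessian similarity) for some $\delta\in[0,L]$, $\frac1n\sum_{i=1}^n\|\nabla f_i(\mathbf x)-\nabla f(\mathbf x)-\nabla f_i(\mathbf y)+\nabla f(\mathbf y)\|_2^2\le\delta^2\|\mathbf x-\mathbf y\|_2^2$ for all $\mathbf x,\mathbf y\in\mathbb R^d$; (ii) (weak convexity) for some $\rho\in[0,L]$, the function $\mathbf x\mapsto f_i(\mathbf x)+\frac\rho2\mathbf x^{T}\mathbf x$ is convex for every $i\in\{1,\dots,n\}$. Then there exists a stepsize $\eta>0$ such that the iterates of SCAFFOLD satisfy $$\frac2T\sum_{r=0}^{R-1}\sum_{k=0}^{\tau-1}\mathbb E\|\nabla f(\bar{\mathbf x}_{2r\tau+\tau+k})\|_2^2\le C\left(\Big(\frac L\tau+\sqrt{L\delta}+\rho\Big)\frac\Delta R+\sqrt{\frac{L\Delta\sigma^2}{n\tau R}}+\frac{(L\Delta\sigma)^{2/3}}{\tau^{1/3}R^{2/3}}\right).$$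
   Context: Setting. There are $n\ge1$ workers and local functions $f_1,\dots,f_n:\mathbb R^d\to\mathbb R$ (possibly non-convex), each differentiable with $L$-Lipschitz continuous gradient, $L>0$. Put $f=\frac1n\sum_{i=1}^n f_i$, assumed bounded below, and $f^*=\inf_{\mathbf x\in\mathbb R^d}f(\mathbf x)$. Stochastic oracle. At iteration $t\in\{0,\dots,T-1\}$, worker $i$ at point $\mathbf x_t^i$ receives $\mathbf g_t^i=G_i(\mathbf x_t^i,\xi_t^i)$, where $G_i$ is a Borel function, the random variables $\xi_t^i$ are i.i.d. over $t$ for each $i$ and independent across workers $i$, and for all $\mathbf x\in\mathbb R^d$: $\mathbb E_{\xi_t^i}[G_i(\mathbf x,\xi_t^i)]=\nabla f_i(\mathbf x)$ and $\mathbb E_{\xi_t^i}\|G_i(\mathbf x,\xi_t^i)-\nabla f_i(\mathbf x)\|_2^2\le\sigma^2$. SCAFFOLD (simplified variant). Let $\tau\ge2$ be an integer, $R\ge1$, $T=2R\tau$, $\eta>0$ the stepsize. Start from a common deterministic point $\mathbf x_0^1=\dots=\mathbf x_0^n$, and write $\bar{\mathbf x}_t=\frac1n\sum_{i=1}^n\mathbf x_t^i$. For $r=0,1,\dots,R-1$: (a) for every $i$ and $k=0,\dots,\tau-1$ set $\mathbf x_{2r\tau+k+1}^i=\mathbf x_{2r\tau+k}^i$; then put $\hat{\mathbf g}_{(r\tau)}^i=\frac1\tau\sum_{k=0}^{\tau-1}\mathbf g_{2r\tau+k}^i$ and $\hat{\mathbf g}_{(r\tau)}=\frac1n\sum_{i=1}^n\hat{\mathbf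 g}_{(r\tau)}^i$; (b) for every $i$ and $k=\tau,\dots,2\tau-2$ set $\mathbf x_{2r\tau+k+1}^i=\mathbf x_{2r\tau+k}^i-\eta\big(\mathbf g_{2r\tau+k}^i-\hat{\mathbf g}_{(r\tau)}^i+\hat{\mathbf g}_{(r\tau)}\big)$; (c) set $\mathbf x_{2(r+1)\tau}^i=\bar{\mathbf x}_{2(r+1)\tau}=\bar{\mathbf x}_{2r\tau}-\frac\eta n\sum_{j=1}^n\sum_{l=\tau}^{2\tau-1}\mathbf g_{2r\tau+l}^j$ for every $i$. The stepsize may depend on all the problem parameters ($L,\Delta,\sigma,\delta,\rho,n,\tau,R$). *)

(* Defs.v *)
From HB Require Import structures.
From mathcomp Require Import all_boot all_order all_algebra.
From mathcomp Require Import all_classical all_reals all_analysis.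
Set Implicit Arguments.
Unset Strict Implicit.
Unset Printing Implicit Defensive.
Import Order.TTheory GRing.Theory Num.Theory.
Import numFieldNormedType.Exports.
Local Open Scope classical_set_scope.
Local Open Scope ring_scope.

(* The library norm `|x| on row vectors is the sup norm; this is the Euclidean
   one.  (The two induce the same topology, so the library's differentiability
   and open sets are the usual ones.) *)
Definition norm2 (R : realType) (d : nat) (x : 'rV[R]_d) : R :=
  Num.sqrt (\sum_(j < d) x 0 j ^+ 2).

(* Meaningful only where f is differentiable. *)
Definition grad (R : realType) (d : nat) (f : 'rV[R]_d -> R) (x : 'rV[R]_d) :
    'rV[R]_d :=
  \row_(j < d) 'D_(delta_mx 0 j) f x.

Definition mean (R : realType) (V : lmodType R) (n : nat) (v : 'I_n -> V) : V :=
  n%:R^-1 *: \sum_(i < n) v i.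

Definition global_obj (R : realType) (n d : nat) (f : 'I_n -> 'rV[R]_d -> R)
    (x : 'rV[R]_d) : R :=
  n%:R^-1 * \sum_(i < n) f i x.

Definition smooth (R : realType) (d : nat) (L : R) (f : 'rV[R]_d -> R) : Prop :=
  (forall x, differentiable f x) /\
  (forall x y, norm2 (grad f x - grad f y) <= L * norm2 (x - y)).

Definition hessian_similarity (R : realType) (n d : nat) (delta : R)
    (f : 'I_n -> 'rV[R]_d -> R) : Prop :=
  forall x y : 'rV[R]_d,
    n%:R^-1 * \sum_(i < n)
      norm2 (grad (f i) x - grad (global_obj f) x
             - grad (f i) y + grad (global_obj f) y) ^+ 2
    <= delta ^+ 2 * norm2 (x - y) ^+ 2.

Definition weakly_convex (R : realType) (d : nat) (rho : R)
    (f : 'rV[R]_d -> R) : Prop :=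
  @convex_function R 'rV[R]_d setT
    (fun x : 'rV[R]_d => f x + rho / 2 * (x *m x^T) 0 0).

(* R^d with its Borel sigma-algebra. *)
Definition borel_rV (R : realType) (d : nat) :=
  g_sigma_algebraType (@open 'rV[R]_d).

Definition mutually_independent (R : realType) (dO dX : measure_display)
    (Om : measurableType dO) (P : probability Om R) (I : finType)
    (Xi : I -> measurableType dX) (xi : forall k : I, Om -> Xi k) : Prop :=
  forall (J : {set I}) (A : forall k : I, set (Xi k)),
    (forall k, measurable (A k)) ->
    P (\bigcap_(k in [set` J]) (xi k @^-1` A k)) =
    (\prod_(k in J) P (xi k @^-1` A k))%E.

(* [xi i t] is the sample used by worker [i] at time [t]; only the times
   t < T matter.  Since the expectations are equal to a finite number, the
   coordinates of [G i x (xi i t _)] are in particular integrable. *)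
Record stochastic_oracle (R : realType) (n d T : nat) (sigma : R)
    (f : 'I_n -> 'rV[R]_d -> R)
    (dO dX : measure_display) (Om : measurableType dO) (P : probability Om R)
    (Xi : 'I_n -> measurableType dX)
    (G : forall i : 'I_n, 'rV[R]_d -> Xi i -> 'rV[R]_d)
    (xi : forall i : 'I_n, nat -> Om -> Xi i) : Prop := {
  oracle_borel : forall i : 'I_n,
    measurable_fun setT
      (fun p : borel_rV R d * Xi i => G i p.1 p.2 : borel_rV R d);
  oracle_measurable : forall (i : 'I_n) (t : nat), (t < T)%N ->
    measurable_fun setT (xi i t);
  oracle_independent :
    @mutually_independent R dO dX Om P ('I_T * 'I_n)%type
      (fun k => Xi k.2) (fun k => xi k.2 k.1);
  oracle_identically_distributed : forall (i : 'I_n) (s t : nat),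
    (s < T)%N -> (t < T)%N -> forall A : set (Xi i), measurable A ->
    P (xi i s @^-1` A) = P (xi i t @^-1` A);
  oracle_unbiased : forall (i : 'I_n) (t : nat), (t < T)%N ->
    forall (x : 'rV[R]_d) (j : 'I_d),
    ('E_P[fun w => (G i x (xi i t w) 0 j)%R])%E = (grad (f i) x 0 j)%:E;
  oracle_variance : forall (i : 'I_n) (t : nat), (t < T)%N ->
    forall x : 'rV[R]_d,
    ('E_P[fun w => (norm2 (G i x (xi i t w) - grad (f i) x) ^+ 2)%R]
       <= (sigma ^+ 2)%:E)%E
}.

(* One trajectory: [x t i] is the iterate and [g t i] the stochastic gradient
   of worker [i] at time [t]. *)
Record scaffold (R : realType) (n d tau rounds : nat) (eta : R)
    (x0 : 'rV[R]_d) (x g : nat -> 'I_n -> 'rV[R]_d)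
    (ghat := fun (r : nat) (i : 'I_n) =>
       tau%:R^-1 *: \sum_(0 <= k < tau) g (2 * r * tau + k)%N i) : Prop := {
  scaffold_init : forall i, x 0%N i = x0;
  scaffold_sample : forall r k i, (r < rounds)%N -> (k < tau)%N ->
    x (2 * r * tau + k + 1)%N i = x (2 * r * tau + k)%N i;
  scaffold_local : forall r k i, (r < rounds)%N ->
    (tau <= k <= 2 * tau - 2)%N ->
    x (2 * r * tau + k + 1)%N i =
    x (2 * r * tau + k)%N i
    - eta *: (g (2 * r * tau + k)%N i - ghat r i + mean (ghat r));
  scaffold_sync : forall r i, (r < rounds)%N ->
    x (2 * (r + 1) * tau)%N i =
    mean (x (2 * r * tau)%N)
    - (eta / n%:R) *: \sum_(j < n) \sum_(tau <= l < 2 * tau)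
                        g (2 * r * tau + l)%N j
}.

(* Main.v *)
Require Import Defs.
From HB Require Import structures.
From mathcomp Require Import all_boot all_order all_algebra.
From mathcomp Require Import all_classical all_reals all_analysis.
From mathcomp Require Import measurable_realfun zify ring lra.
Set Implicit Arguments.
Unset Strict Implicit.
Unset Printing Implicit Defensive.
Import Order.TTheory GRing.Theory Num.Theory.
Import numFieldNormedType.Exports.
Local Open Scope classical_set_scope.
Local Open Scope ring_scope.

(** One round starts from a common point [X].  After it, the averaged iterate
    follows virtual stochastic gradient steps [y_(k+1) = y_k - eta (m_k + z_k)],
    where [m_k] is the average of the local gradients at the local iterates and
    [z_k] the average noise, because the control variates have mean zero over
    the workers; the same recursion covers the final synchronisation.  Let
    [e_k] be the expected consensus error (the mean squared distance of the
    local iterates to [y_k]), [p_k] the expected value of [|y_k - X|^2] and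
    [s_k] that of [|m_k|^2].

    - Descent ([descent_step]): the expected objective decreases by [eta / 2]
      times the squared gradient norm, plus [eta / 4] times [s_k], up to
      [(eta / 2) L^2 e_k] and noise of size [L eta^2 sigma^2 / (2 n)].
    - Consensus ([consensus_step], [deviation_le]): weak convexity makes a local
      gradient step almost nonexpansive ([weakly_convex_step]), so [e_k] grows by
      a factor [1 + 1 / (2 tau)] only.  Hessian similarity is needed just for the
      gradient differences between the common points [y_k] and [X], where it
      contributes [tau eta^2 delta^2 p_k].  The fresh noise and the noise of the
      control variate, of variance [sigma^2 / tau], contribute [eta^2 sigma^2].
    - Distance: [p_k] grows by the same factor, plus [tau eta^2 s_k] and noise.

    A discrete Gronwall argument ([gronwall]) bounds the sum of [L^2 e_k] by
    half of the sum of [s_k], which descent absorbs, plus a noise term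
    ([round_bound]).  Telescoping over the rounds gives
    [Delta / (eta tau rounds) + L eta sigma^2 / n + L^2 tau eta^2 sigma^2] up to
    constants, and [stepsize] balances these terms.

    All noise terms are handled by orthogonality: conditionally on the earlier
    samples, and on the simultaneous samples of the other workers, a stochastic
    gradient has the exact gradient as mean and variance at most [sigma^2].
    Conditioning is expressed through the sigma-algebra generated by a set of
    samples ([sample_space]): a sample outside this set is independent of it
    ([sample_indep], by uniqueness of measures on a pi-system), so the joint law
    is a product and Fubini's theorem lets one integrate over the new sample with
    everything else frozen ([freezing]). *)

(** * Euclidean geometry of row vectors *)

(** The Euclidean inner product and the squared Euclidean norm. *)
Definition dot (R : realType) (d : nat) (u v : 'rV[R]_d) : R :=
  \sum_(j < d) u 0 j * v 0 j.

Definition sq (R : realType) (d : nat) (u : 'rV[R]_d) : R := dot u u.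

Section Euclid.
Context {R : realType} {d : nat}.
Implicit Types (u v w : 'rV[R]_d) (a b : R).

Lemma dotC u v : dot u v = dot v u.
Proof. by apply: eq_bigr => j _; rewrite mulrC. Qed.

Lemma dotDl u v w : dot (u + v) w = dot u w + dot v w.
Proof. by rewrite -big_split /=; apply: eq_bigr => j _; rewrite !mxE mulrDl. Qed.

Lemma dotZl a u v : dot (a *: u) v = a * dot u v.
Proof. by rewrite mulr_sumr; apply: eq_bigr => j _; rewrite !mxE mulrA. Qed.

Lemma dotNl u v : dot (- u) v = - dot u v.
Proof. by rewrite -scaleN1r dotZl mulN1r. Qed.

Lemma dotBl u v w : dot (u - v) w = dot u w - dot v w.
Proof. by rewrite dotDl dotNl. Qed.

Lemma dotDr u v w : dot u (v + w) = dot u v + dot u w.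
Proof. by rewrite ![dot u _]dotC dotDl. Qed.

Lemma dotZr a u v : dot u (a *: v) = a * dot u v.
Proof. by rewrite ![dot u _]dotC dotZl. Qed.

Lemma dotNr u v : dot u (- v) = - dot u v.
Proof. by rewrite ![dot u _]dotC dotNl. Qed.

Lemma dotBr u v w : dot u (v - w) = dot u v - dot u w.
Proof. by rewrite dotDr dotNr. Qed.

Lemma dot0l u : dot 0 u = 0.
Proof. by rewrite -(scale0r 0) dotZl mul0r. Qed.

Lemma dot_suml (I : Type) (r : seq I) (F : I -> 'rV[R]_d) v :
  dot (\sum_(i <- r) F i) v = \sum_(i <- r) dot (F i) v.
Proof.
apply: (big_morph (fun u => dot u v)); last exact: dot0l.
by move=> x y; exact: dotDl.
Qed.

Lemma dot_sumr (I : Type) (r : seq I) (F : I -> 'rV[R]_d) v :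
  dot v (\sum_(i <- r) F i) = \sum_(i <- r) dot v (F i).
Proof. by rewrite dotC dot_suml; apply: eq_bigr => i _; rewrite dotC. Qed.

Lemma sq_ge0 u : 0 <= sq u.
Proof. by apply: sumr_ge0 => j _; rewrite -expr2 sqr_ge0. Qed.

Lemma norm2_sqr u : norm2 u ^+ 2 = sq u.
Proof.
have -> : norm2 u = Num.sqrt (sq u).
  by congr Num.sqrt; apply: eq_bigr => j _; rewrite expr2.
by rewrite sqr_sqrtr ?sq_ge0.
Qed.

Lemma norm2_ge0 u : 0 <= norm2 u.
Proof. exact: sqrtr_ge0. Qed.

Lemma sq0 : sq (0 : 'rV[R]_d) = 0.
Proof. exact: dot0l. Qed.

Lemma sqZ a u : sq (a *: u) = a ^+ 2 * sq u.
Proof. by rewrite /sq dotZl dotZr mulrA expr2. Qed.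

Lemma sqN u : sq (- u) = sq u.
Proof. by rewrite /sq dotNl dotNr opprK. Qed.

Lemma sqD u v : sq (u + v) = sq u + 2 * dot u v + sq v.
Proof. by rewrite /sq dotDl !dotDr (dotC v u); ring. Qed.

Lemma sqB u v : sq (u - v) = sq u - 2 * dot u v + sq v.
Proof. by rewrite sqD dotNr sqN; ring. Qed.

Lemma sqBC u v : sq (u - v) = sq (v - u).
Proof. by rewrite -sqN opprB. Qed.

Lemma coord_sqr_le u j : u 0 j ^+ 2 <= sq u.
Proof.
rewrite /sq /dot (bigD1 j)//= -expr2 lerDl.
by apply: sumr_ge0 => i _; rewrite -expr2 sqr_ge0.
Qed.

(** Young's inequality, in the forms used for products and for sums. *)
Lemma dot_young a u v : 0 < a -> 2 * dot u v <= a * sq u + a^-1 * sq v.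
Proof.
move=> a0; have := sq_ge0 (a *: u - v); rewrite sqB sqZ dotZl => h.
rewrite -subr_ge0 -(pmulr_rge0 _ a0).
have -> : a * (a * sq u + a^-1 * sq v - 2 * dot u v) =
  a ^+ 2 * sq u - 2 * (a * dot u v) + sq v by field; rewrite gt_eqF.
exact: h.
Qed.

Lemma sqD_young a u v : 0 < a ->
  sq (u + v) <= (1 + a) * sq u + (1 + a^-1) * sq v.
Proof. by move=> a0; rewrite sqD; have := dot_young u v a0; lra. Qed.

Lemma sqD_le u v : sq (u + v) <= 2 * sq u + 2 * sq v.
Proof. by have := @sqD_young 1 u v ltr01; rewrite invr1 -natr1. Qed.

Lemma sqB_le u v : sq (u - v) <= 2 * sq u + 2 * sq v.
Proof. by rewrite -(sqN v) sqD_le. Qed.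

Section Means.
Context {n : nat} (n_gt0 : (0 < n)%N).
Implicit Types (U V : 'I_n -> 'rV[R]_d).

Let nz : n%:R != 0 :> R. Proof. by rewrite pnatr_eq0 -lt0n. Qed.

Lemma sum_mean V : \sum_i V i = n%:R *: mean V.
Proof. by rewrite /mean scalerA mulfV// scale1r. Qed.

Lemma meanB U V : mean (fun i => U i - V i) = mean U - mean V.
Proof. by rewrite /mean sumrB scalerBr. Qed.

Lemma meanD U V : mean (fun i => U i + V i) = mean U + mean V.
Proof. by rewrite /mean big_split scalerDr. Qed.

Lemma meanZ a V : mean (fun i => a *: V i) = a *: mean V.
Proof. by rewrite /mean -scaler_sumr !scalerA mulrC. Qed.

Lemma mean_cst u : mean (fun _ : 'I_n => u) = u.
Proof.
by rewrite /mean sumr_const card_ord -[u *+ n]scaler_nat scalerA mulVf// scale1r.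
Qed.

(** The squared deviations from the mean sum to at most the squared norms. *)
Lemma sum_sq_center V :
  \sum_i sq (V i - mean V) = \sum_i sq (V i) - n%:R * sq (mean V).
Proof.
under eq_bigr do rewrite sqB.
rewrite big_split/= sumrB -mulr_sumr -dot_suml sum_mean dotZl.
by rewrite sumr_const card_ord -[sq _ *+ n]mulr_natl /sq; ring.
Qed.

Lemma sum_sq_center_le V : \sum_i sq (V i - mean V) <= \sum_i sq (V i).
Proof.
by rewrite sum_sq_center lerBlDr lerDl mulr_ge0 ?sq_ge0.
Qed.

Lemma sq_mean_le V : sq (mean V) <= n%:R^-1 * \sum_i sq (V i).
Proof.
rewrite ler_pdivlMl ?ltr0n// -subr_ge0 -sum_sq_center.
by apply: sumr_ge0 => i _; exact: sq_ge0.
Qed.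

End Means.
End Euclid.

(** * Smooth and weakly convex functions *)

Section Smooth.
Context {R : realType} {d : nat}.
Implicit Types (f : 'rV[R]_d -> R) (x y h : 'rV[R]_d) (L rho : R).

Lemma derive_grad f x h : differentiable f x -> 'D_h f x = dot (grad f x) h.
Proof.
move=> df; rewrite deriveE// {1}(row_sum_delta h) linear_sum /=.
apply: eq_bigr => j _; rewrite linearZ/= mxE deriveE//.
by rewrite mulrC.
Qed.

Lemma is_derive_line f x h (t : R) : differentiable f (x + t *: h) ->
  is_derive t 1 (fun s : R => f (x + s *: h)) (dot (grad f (x + t *: h)) h).
Proof.
move=> df; set g := fun s : R => _.
have E : (fun k : R => k^-1 *: ((g \o shift t) (k *: 1) - g t)) =
    (fun k : R => k^-1 *: ((f \o shift (x + t *: h)) (k *: h) - f (x + t *: h))).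
  apply/funext => k; congr (_ *: (_ - _)); rewrite /g /=; congr f.
  by rewrite [k *: 1]mulr1 scalerDl addrCA.
apply: DeriveDef.
  by have := @diff_derivable _ _ _ f _ h df; rewrite /derivable -E.
by rewrite -derive_grad// /derive -E.
Qed.

Lemma smooth_sq L f x y : 0 <= L -> smooth L f ->
  sq (grad f x - grad f y) <= L ^+ 2 * sq (x - y).
Proof.
move=> L0 [_ /(_ x y) h]; rewrite -!norm2_sqr -exprMn.
by rewrite lerXn2r// nnegrE ?mulr_ge0 ?norm2_ge0.
Qed.

(** The second-order Taylor bound, for [f] and (when [s] is true) for [- f]. *)
Lemma smooth_taylor L f x h (s : bool) : 0 < L -> smooth L f ->
  (-1) ^+ s * (f (x + h) - f x - dot (grad f x) h) <= L / 2 * sq h.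
Proof.
move=> L0 sf; have [df _] := sf; set e : R := (-1) ^+ s.
have e2 : e ^+ 2 = 1 by rewrite /e sqrr_sign.
pose phi (t : R) := e * f (x + t *: h) - e * dot (grad f x) h * t
  - L / 2 * sq h * t ^+ 2.
pose dphi (t : R) := e * dot (grad f (x + t *: h)) h - e * dot (grad f x) h
  - L * sq h * t.
have phiD (t : R) : is_derive t 1 phi (dphi t).
  rewrite /phi /dphi.
  have := is_derive_line (df (x + t *: h)) => D.
  apply: is_derive_eq.
  by rewrite /GRing.scale/= !(mulr0, mul0r, addr0, add0r, mulr1, expr1); lra.
have [//|c cI E] := @MVT R phi dphi 0 1 ltr01 (fun t _ => phiD t).
  apply: continuous_subspaceT => t.
  by apply: differentiable_continuous; apply/derivable1_diffP; exact: ex_derive.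
have c0 : 0 < c by move: cI; rewrite in_itv/= => /andP[].
suff : dphi c <= 0.
  move: E; rewrite subr0 mulr1 => <-.
  by rewrite /phi scale1r scale0r addr0; lra.
rewrite /dphi -mulrBr -dotBl -dotZl.
have := dot_young (e *: (grad f (x + c *: h) - grad f x)) h
  (divr_gt0 (@ltr01 R) (mulr_gt0 L0 c0)).
rewrite invf_div divr1 sqZ e2 mul1r.
have := smooth_sq (x + c *: h) x (ltW L0) sf.
rewrite addrAC subrr add0r sqZ; set S := sq (_ - _) => hS.
have : 1 / (L * c) * S <= L * c * sq h.
  rewrite mul1r ler_pdivrMl ?mulr_gt0//.
  by apply: le_trans hS _; rewrite le_eqVlt; apply/orP; left; apply/eqP; ring.
by lra.
Qed.

Lemma smooth_descent L f x y : 0 < L -> smooth L f ->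
  f y <= f x + dot (grad f x) (y - x) + L / 2 * sq (y - x).
Proof.
move=> L0 sf; have := @smooth_taylor L f x (y - x) false L0 sf.
by rewrite expr0 mul1r subrKC; lra.
Qed.

Lemma smooth_ascent L f x y : 0 < L -> smooth L f ->
  f x + dot (grad f x) (y - x) - L / 2 * sq (y - x) <= f y.
Proof.
move=> L0 sf; have := @smooth_taylor L f x (y - x) true L0 sf.
by rewrite expr1 subrKC; lra.
Qed.

(** First-order form of weak convexity: a tangent plane minus a paraboloid of
    curvature [rho] lies below the graph. *)
Lemma weakly_convex_tangent L rho f x y : 0 < L -> smooth L f ->
  weakly_convex rho f ->
  f x + dot (grad f x) (y - x) - rho / 2 * sq (y - x) <= f y.
Proof.
move=> L0 sf cf; set h := y - x.
have mulE (v : 'rV[R]_d) : (v *m v^T) 0 0 = sq v.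
  by rewrite mxE; apply: eq_bigr => j _; rewrite mxE.
(* the convexity inequality at x + t h, divided by t, for every small t *)
have H (t : R) : 0 < t -> t <= 1 ->
    dot (grad f x) h <= f y - f x + rho / 2 * sq h
      + t * ((L / 2 - rho / 2) * sq h).
  move=> t0 t1.
  have : f (t *: y + (1 - t) *: x)
        + rho / 2 * ((t *: y + (1 - t) *: x) *m (t *: y + (1 - t) *: x)^T) 0 0
      <= t * (f y + rho / 2 * (y *m y^T) 0 0)
        + (1 - t) * (f x + rho / 2 * (x *m x^T) 0 0).
    by apply: (cf (Itv01 (ltW t0) t1) y x); rewrite inE.
  rewrite !mulE.
  have -> : t *: y + (1 - t) *: x = x + t *: h.
    by rewrite /h scalerBr scalerBl scale1r addrCA.
  have := @smooth_ascent L f x (x + t *: h) L0 sf.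
  rewrite (addrC x) addrK dotZr sqZ (sqD _ x) sqZ dotZl.
  have -> : sq y = sq h + 2 * dot h x + sq x by rewrite -sqD /h subrK.
  move=> A B; rewrite -(ler_pM2l t0); nra.
apply/ler_addgt0Pl => e e0.
set c := (L / 2 - rho / 2) * sq h in H.
pose t := Num.min 1 (e / (`|c| + 1)).
have c1 : 0 < `|c| + 1 by rewrite ltr_wpDl.
have t0 : 0 < t by rewrite lt_min ltr01 divr_gt0.
have t1 : t <= 1 by rewrite ge_min lexx.
have tc : t * c <= e.
  apply: (@le_trans _ _ (t * (`|c| + 1))).
    by rewrite ler_pM2l//; have := ler_norm c; lra.
  by rewrite -ler_pdivlMr// ge_min lexx orbT.
by have := H t t0 t1; lra.
Qed.

(** Almost-cocoercivity of the gradient of a weakly convex smooth function: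
    both sides of the quadratic bounds are compared at [y] and [z] moved by
    opposite multiples of the gradient difference. *)
Lemma weakly_convex_cocoercive L rho f y z : 0 < L -> 0 <= rho <= L ->
  smooth L f -> weakly_convex rho f ->
  (3 * L)^-1 * sq (grad f y - grad f z) - 2 * rho * sq (y - z) <=
  dot (grad f y - grad f z) (y - z).
Proof.
move=> L0 /andP[r0 rL] sf cf; set D := grad f y - grad f z; set u := y - z.
pose c := (3 * L)^-1.
have c0 : 0 < c by rewrite invr_gt0 mulr_gt0.
have cL : L * c = 3^-1 by rewrite /c; field; rewrite gt_eqF.
have h1 := @smooth_descent L f y (y - c *: D) L0 sf.
have h2 := @weakly_convex_tangent L rho f z (y - c *: D) L0 sf cf.
have h3 := @smooth_descent L f z (z + c *: D) L0 sf.
have h4 := @weakly_convex_tangent L rho f y (z + c *: D) L0 sf cf.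
have e1 : y - c *: D - y = - (c *: D) by rewrite addrAC subrr add0r.
have e2 : y - c *: D - z = u - c *: D by rewrite addrAC.
have e3 : z + c *: D - z = c *: D by rewrite addrAC subrr add0r.
have e4 : z + c *: D - y = - (u - c *: D) by rewrite /u !opprB (addrC z) addrA.
move: h1 h2 h3 h4; rewrite e1 e2 e3 e4 !sqN !sqZ.
rewrite !dotNr !dotBr !dotZr => h1 h2 h3 h4.
have h5 : sq (u - c *: D) <= 2 * sq u + 2 * (c ^+ 2 * sq D).
  by rewrite -sqZ sqB_le.
have h6 : rho * sq (u - c *: D) <= rho * (2 * sq u) + L * (2 * (c ^+ 2 * sq D)).
  apply: le_trans (ler_wpM2l r0 h5) _; rewrite mulrDr lerD2l.
  by rewrite ler_wpM2r// mulr_ge0// mulr_ge0 ?sqr_ge0 ?sq_ge0.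
have E1 : L * (c ^+ 2 * sq D) = 3^-1 * (c * sq D) by rewrite -cL; ring.
have E2 v : dot D v = dot (grad f y) v - dot (grad f z) v by rewrite dotBl.
have E3 : sq D = dot (grad f y) D - dot (grad f z) D by rewrite /sq {1}/D dotBl.
rewrite !E2 -/c.
have E4 : c * sq D = c * dot (grad f y) D - c * dot (grad f z) D.
  by rewrite E3; ring.
lra.
Qed.

(** A gradient step of a weakly convex smooth function is almost
    nonexpansive. *)
Lemma weakly_convex_step L rho eta f y z : 0 < L -> 0 <= rho <= L ->
  smooth L f -> weakly_convex rho f -> 0 < eta -> eta * L <= 2 / 3 ->
  sq (y - z - eta *: (grad f y - grad f z)) <=
  (1 + 4 * eta * rho) * sq (y - z).
Proof.
move=> L0 rL sf cf e0 eL.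
have := weakly_convex_cocoercive y z L0 rL sf cf.
set D := grad f y - grad f z; set u := y - z => h.
rewrite sqB dotZr sqZ (dotC u).
have := ler_wpM2l (ltW e0) h.
have : eta ^+ 2 * sq D <= 2 * (eta * ((3 * L)^-1 * sq D)).
  have -> : 2 * (eta * ((3 * L)^-1 * sq D)) = eta * (2 / (3 * L)) * sq D by ring.
  apply: ler_wpM2r; first exact: sq_ge0.
  rewrite expr2 ler_pM2l//.
  by rewrite ler_pdivlMr ?mulr_gt0//; lra.
by lra.
Qed.

End Smooth.

Section GlobalObjective.
Context {R : realType} {n d : nat} (n_gt0 : (0 < n)%N).
Variables (f : 'I_n -> 'rV[R]_d -> R) (L : R).
Hypotheses (L_gt0 : 0 < L) (f_smooth : forall i, smooth L (f i)).

Lemma grad_global x : grad (global_obj f) x = mean (fun i => grad (f i) x).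
Proof.
apply/rowP => j; rewrite !mxE summxE.
have -> : global_obj f = n%:R^-1 \*: \sum_(i < n) f i.
  by apply/funext => y; rewrite /global_obj/= fct_sumE.
have D i : derivable (f i) x (delta_mx 0 j).
  by apply: diff_derivable; exact: (f_smooth i).1.
rewrite deriveZ//; last exact: derivable_sum.
by congr (_ * _); rewrite derive_sum//; apply: eq_bigr => i _; rewrite mxE.
Qed.

Lemma global_diff x : differentiable (global_obj f) x.
Proof.
have -> : global_obj f = n%:R^-1 \*: \sum_(i < n) f i.
  by apply/funext => y; rewrite /global_obj/= fct_sumE.
apply: differentiableZ; apply: differentiable_sum => i.
exact: (f_smooth i).1.
Qed.

Lemma global_smooth : smooth L (global_obj f).
Proof.
split; first exact: global_diff.
move=> x y.
rewrite -[leLHS]ger0_norm ?norm2_ge0// -[leRHS]ger0_norm; last first.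
  by rewrite mulr_ge0 ?norm2_ge0 ?ltW.
rewrite -ler_sqr ?nnegrE ?normr_ge0//.
rewrite !real_normK ?num_real// exprMn !norm2_sqr.
rewrite !grad_global -meanB.
apply: le_trans (sq_mean_le n_gt0 _) _.
rewrite ler_pdivrMl ?ltr0n//.
apply: le_trans (_ : \sum_(i < n) L ^+ 2 * sq (x - y) <= _); last first.
  by rewrite sumr_const card_ord -[_ *+ n]mulr_natl.
by apply: ler_sum => i _; apply: smooth_sq => //; exact: ltW.
Qed.

End GlobalObjective.

(** * Pathwise inequalities for one step *)

Section OneStep.
Context {R : realType} {n d : nat} (n_gt0 : (0 < n)%N).
Variables (f : 'I_n -> 'rV[R]_d -> R) (L rho delta eta : R).
Hypotheses (L_gt0 : 0 < L) (f_smooth : forall i, smooth L (f i)).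
Hypotheses (eta_gt0 : 0 < eta) (Y : 'I_n -> 'rV[R]_d).

Notation F := (global_obj f).
Notation y := (mean Y).

(** Mean squared distance to the mean: the consensus error. *)
Definition consensus_error (V : 'I_n -> 'rV[R]_d) : R :=
  n%:R^-1 * \sum_i sq (V i - mean V).

Lemma gradient_drift :
  sq (grad F y - mean (fun i => grad (f i) (Y i))) <= L ^+ 2 * consensus_error Y.
Proof.
rewrite (grad_global f_smooth) -meanB.
apply: le_trans (sq_mean_le n_gt0 _) _; rewrite mulrCA.
apply: ler_wpM2l; first by rewrite invr_ge0.
rewrite mulr_sumr; apply: ler_sum => i _; rewrite sqBC.
by apply: smooth_sq => //; exact: ltW.
Qed.

(** Descent for the averaged iterate, with the noise [z] of the averaged
    gradient. *)
Lemma descent_step (z : 'rV[R]_d) (m := mean (fun i => grad (f i) (Y i))) :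
  F (y - eta *: (m + z)) <= F y - eta / 2 * sq (grad F y)
    - eta / 2 * (1 - L * eta) * sq m + eta / 2 * L ^+ 2 * consensus_error Y
    + (L * eta ^+ 2 * dot m z - eta * dot (grad F y) z)
    + L * eta ^+ 2 / 2 * sq z.
Proof.
have h := smooth_descent y (y - eta *: (m + z)) L_gt0
  (global_smooth n_gt0 L_gt0 f_smooth).
have e : y - eta *: (m + z) - y = - (eta *: (m + z)).
  by rewrite addrAC subrr add0r.
move: h; rewrite e sqN sqZ dotNr dotZr dotDr sqD => h.
have drift := gradient_drift; rewrite -/m sqB in drift.
have := ler_wpM2l (ltW (divr_gt0 eta_gt0 (ltr0Sn R 1))) drift.
by lra.
Qed.

Variables (X c : 'rV[R]_d) (zeta zhat : 'I_n -> 'rV[R]_d).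

(** The deviation of worker [i] before its fresh noise is added; the control
    variate has noise [zhat i]. *)
Definition deviation (i : 'I_n) : 'rV[R]_d :=
  (Y i - y - eta *: (grad (f i) (Y i) - grad (f i) y))
  - eta *: ((grad (f i) y - grad F y - grad (f i) X + grad F X) - zhat i).

(** The new iterates [Z] differ from [deviation i - eta *: zeta i] by a vector
    common to all workers, which does not affect the consensus error. *)
Lemma consensus_step (Z : 'I_n -> 'rV[R]_d) :
  (forall i, Z i = Y i - eta *: (grad (f i) (Y i) + zeta i
      - (grad (f i) X + zhat i) + c)) ->
  consensus_error Z <= n%:R^-1 * \sum_i sq (deviation i - eta *: zeta i).
Proof.
move=> hZ; pose b : 'rV[R]_d := y - eta *: (grad F y - grad F X + c).
have ZE i : Z i = (deviation i - eta *: zeta i) + b.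
  apply/rowP => j; rewrite hZ /deviation /b.
  move: y => yb; rewrite !mxE.
  by ring.
have mZ : mean Z = mean (fun i => deviation i - eta *: zeta i) + b.
  rewrite -[in RHS](mean_cst n_gt0 b) -meanD; congr mean.
  by apply/funext => i; rewrite ZE.
apply: ler_wpM2l; first by rewrite invr_ge0.
apply: le_trans (sum_sq_center_le n_gt0 _).
apply: ler_sum => i _; rewrite ZE mZ opprD addrACA subrr addr0.
exact: lexx.
Qed.

Hypotheses (rho_le : 0 <= rho <= L) (f_wcvx : forall i, weakly_convex rho (f i)).
Hypothesis (f_sim : hessian_similarity delta f).
Hypothesis eta_L : eta * L <= 2 / 3.

(** Weak convexity bounds the gradient step towards the average; Hessian
    similarity bounds the heterogeneity between the average and [X]. *)
Lemma deviation_le (a : R) : 0 < a ->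
  n%:R^-1 * \sum_i sq (deviation i) <=
  (1 + a) * (1 + 4 * eta * rho) * consensus_error Y
  + 2 * (1 + a^-1) * eta ^+ 2 * (delta ^+ 2 * sq (y - X)
      + n%:R^-1 * \sum_i sq (zhat i)).
Proof.
move=> a0.
pose H i := grad (f i) y - grad F y - grad (f i) X + grad F X.
have a1 : 0 < 1 + a^-1 by rewrite ltr_wpDr// invr_ge0 ltW.
have dev i : sq (deviation i) <=
    (1 + a) * (1 + 4 * eta * rho) * sq (Y i - y)
    + 2 * (1 + a^-1) * eta ^+ 2 * (sq (H i) + sq (zhat i)).
  apply: le_trans (sqD_young _ _ a0) _; rewrite sqN sqZ; apply: lerD.
    rewrite -mulrA; apply: ler_wpM2l; first by rewrite addr_ge0// ltW.
    exact: (weakly_convex_step (Y i) y L_gt0 rho_le (f_smooth i) (f_wcvx i)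
      eta_gt0 eta_L).
  have -> : 2 * (1 + a^-1) * eta ^+ 2 * (sq (H i) + sq (zhat i)) =
    (1 + a^-1) * (eta ^+ 2 * (2 * sq (H i) + 2 * sq (zhat i))) by ring.
  apply: ler_wpM2l; first exact: ltW.
  by apply: ler_wpM2l; [exact: sqr_ge0|exact: sqB_le].
have sum_dev : \sum_i sq (deviation i) <=
    (1 + a) * (1 + 4 * eta * rho) * (\sum_i sq (Y i - y))
    + 2 * (1 + a^-1) * eta ^+ 2 * (\sum_i sq (H i) + \sum_i sq (zhat i)).
  by rewrite -big_split/= !mulr_sumr -big_split; apply: ler_sum => i _.
have n0 : 0 <= n%:R^-1 :> R by rewrite invr_ge0.
apply: le_trans (ler_wpM2l n0 sum_dev) _.
rewrite /consensus_error mulrDr mulrCA lerD2l mulrCA.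
apply: ler_wpM2l; first by rewrite mulr_ge0 ?sqr_ge0// mulr_ge0// ltW.
rewrite mulrDr lerD2r.
have := f_sim y X; rewrite norm2_sqr.
by under eq_bigr do rewrite norm2_sqr.
Qed.

End OneStep.

(** * Recursions satisfied by the expected errors of one round *)

Section Recursions.
Context {R : realType}.

(** A recursion with growth factor [1 + 1 / (2 tau)] amplifies its forcing
    term by at most [2] over [tau] steps: [(1 - k / (2 tau)) * a k] grows by at
    most [b k] per step. *)
Lemma gronwall (tau m : nat) (a b : nat -> R) : (0 < tau)%N -> (m <= tau)%N ->
  a 0%N = 0 -> (forall k, (k < m)%N -> 0 <= a k) ->
  (forall k, (k < m)%N -> 0 <= b k) ->
  (forall k, (k < m)%N -> a k.+1 <= (1 + (2 * tau%:R)^-1) * a k + b k) ->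
  forall k, (k <= m)%N -> 0 <= a k -> a k <= 2 * \sum_(0 <= j < k) b j.
Proof.
move=> t0 mt a0 age bge H.
have t0R : 0 < tau%:R :> R by rewrite ltr0n.
pose c : R := (2 * tau%:R)^-1.
have c0 : 0 < c by rewrite invr_gt0 mulr_gt0.
have wk k : (k <= m)%N -> 2^-1 <= 1 - k%:R * c.
  move=> km; have : k%:R * c <= tau%:R * c.
    by rewrite ler_pM2r// ler_nat (leq_trans km).
  have -> : tau%:R * c = 2^-1 by rewrite /c; field; rewrite gt_eqF.
  by lra.
have P k : (k <= m)%N -> (1 - k%:R * c) * a k <= \sum_(0 <= j < k) b j.
  elim: k => [|k IH] km; first by rewrite a0 mulr0 big_nil.
  rewrite big_nat_recr//=.
  have w1 := wk _ km; have h := H _ km; have IHk := IH (ltnW km).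
  have ak := age _ km; have bk := bge _ km.
  have h2 : (1 - k.+1%:R * c) * a k.+1 <=
      (1 - k.+1%:R * c) * ((1 + c) * a k + b k).
    by apply: ler_wpM2l => //; lra.
  apply: le_trans h2 _; apply: le_trans (lerD IHk (lexx _)).
  rewrite mulrDr; apply: lerD.
    rewrite mulrA; apply: ler_wpM2r => //.
    have k0 : 0 <= k%:R :> R by [].
    by rewrite -natr1; nra.
  rewrite ler_piMl//.
  have k0 : 0 <= k.+1%:R :> R by [].
  by rewrite gerBl mulr_ge0// ltW.
move=> k km ak; have := P k km; have w1 := wk _ km.
have : 2^-1 * a k <= (1 - k%:R * c) * a k by apply: ler_wpM2r.
by lra.
Qed.

Lemma sum_le_cst (k tau : nat) (s : nat -> R) (c : R) : (k <= tau)%N -> 0 <= c ->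
  (forall j, (j < k)%N -> s j <= c) -> \sum_(0 <= j < k) s j <= tau%:R * c.
Proof.
move=> kt c0 h; apply: (@le_trans _ _ (\sum_(0 <= j < k) c)).
  by apply: ler_sum_nat => j /andP[_ jk]; exact: h.
rewrite sumr_const_nat subn0 -[_ *+ k]mulr_natl.
by apply: ler_wpM2r => //; rewrite ler_nat.
Qed.

Lemma sum_prefix_le (k tau : nat) (s : nat -> R) : (k <= tau)%N ->
  (forall j, (j < tau)%N -> 0 <= s j) ->
  \sum_(0 <= j < k) s j <= \sum_(0 <= j < tau) s j.
Proof.
move=> kt h; rewrite [leRHS](@big_cat_nat _ _ _ k)//= lerDl big_nat.
by apply: sumr_ge0 => j /andP[_ jt]; exact: h.
Qed.

(** The descent, drift and consensus recursions of one round combine into a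
    bound on the sum of squared gradients.  In the application [F] is the
    expected objective, [Gr] the expected squared gradient norm, [s] that of
    the average local gradient, [p] the expected squared distance to the
    starting point of the round and [e] the expected consensus error. *)
Lemma round_bound (tau n : nat) (L delta eta v : R) (F Gr s p e : nat -> R) :
  (0 < tau)%N -> (0 < n)%N -> 0 < L -> 0 <= delta <= L -> 0 < eta -> 0 <= v ->
  L * eta <= 2^-1 -> tau%:R ^+ 2 * eta ^+ 2 * (L * delta) <= 72^-1 ->
  p 0%N = 0 -> e 0%N = 0 ->
  (forall k, (k < tau)%N -> 0 <= s k) ->
  (forall k, (k < tau)%N -> 0 <= p k) ->
  (forall k, (k < tau)%N -> 0 <= e k) ->
  (forall k, (k < tau)%N ->
    F k.+1 <= F k - eta / 2 * Gr k - eta / 2 * (1 - L * eta) * s k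
      + eta / 2 * L ^+ 2 * e k + L * eta ^+ 2 / 2 * (v / n%:R)) ->
  (forall k, (k.+1 < tau)%N ->
    p k.+1 <= (1 + (2 * tau%:R)^-1) * p k + 3 * tau%:R * eta ^+ 2 * s k
      + eta ^+ 2 * v) ->
  (forall k, (k.+1 < tau)%N ->
    e k.+1 <= (1 + (2 * tau%:R)^-1) * e k
      + 18 * tau%:R * eta ^+ 2 * delta ^+ 2 * p k + 19 * eta ^+ 2 * v) ->
  \sum_(0 <= k < tau) Gr k <= 2 / eta * (F 0%N - F tau)
    + 39 * L ^+ 2 * tau%:R ^+ 2 * eta ^+ 2 * v + tau%:R * L * eta * (v / n%:R).
Proof.
move=> t0 n0 L0 /andP[d0 dL] eta0 v0 Le hd p0 e0 sge pge ege HF Hp He.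
have t0R : 0 < tau%:R :> R by rewrite ltr0n.
set S := \sum_(0 <= k < tau) s k.
have S0 : 0 <= S.
  by rewrite /S big_nat; apply: sumr_ge0 => k /andP[_ kt]; exact: sge.
set x := eta ^+ 2.
have x0 : 0 <= x by rewrite sqr_ge0.
have xv0 : 0 <= x * v by rewrite mulr_ge0.
have tx0 : 0 <= 3 * tau%:R * x by rewrite mulr_ge0// mulr_ge0// ltW.
have m1 : (tau.-1 <= tau)%N by exact: leq_pred.
have lt1 k : (k < tau.-1)%N -> (k.+1 < tau)%N by case: (tau) t0.
have lt2 k : (k < tau.-1)%N -> (k < tau)%N by move=> /lt1/ltnW.
have le1 k : (k < tau)%N -> (k <= tau.-1)%N by case: (tau) t0.
pose Pb := 6 * tau%:R * x * S + 2 * tau%:R * x * v.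
have Pb0 : 0 <= Pb.
  by rewrite addr_ge0// -!mulrA !mulr_ge0// ltW.
have pb k : (k < tau)%N -> p k <= Pb.
  move=> kt.
  have := @gronwall tau tau.-1 p (fun k => 3 * tau%:R * x * s k + x * v)
    t0 m1 p0 (fun k h => pge k (lt2 k h)) _ _ k (le1 k kt) (pge k kt).
  move=> h; apply: le_trans (h _ _) _ => {h}.
  - by move=> j /lt2 jt; rewrite addr_ge0// mulr_ge0// sge.
  - by move=> j /lt1 jt; rewrite addrA; exact: Hp.
  - rewrite big_split/= -mulr_sumr.
    have hs := sum_prefix_le (ltnW kt) sge; rewrite -/S in hs.
    have h1 := ler_wpM2l tx0 hs.
    have h2 := @sum_le_cst k tau (fun=> x * v) _ (ltnW kt) xv0
      (fun _ _ => lexx _).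
    by rewrite /Pb; lra.
pose Eb := 2 * (tau%:R * (18 * tau%:R * x * delta ^+ 2 * Pb + 19 * x * v)).
have c0 : 0 <= 18 * tau%:R * x * delta ^+ 2.
  by rewrite !mulr_ge0 ?sqr_ge0// ltW.
have xv19 : 0 <= 19 * x * v by rewrite -mulrA mulr_ge0.
have eb k : (k < tau)%N -> e k <= Eb.
  move=> kt.
  have := @gronwall tau tau.-1 e
    (fun k => 18 * tau%:R * x * delta ^+ 2 * p k + 19 * x * v)
    t0 m1 e0 (fun k h => ege k (lt2 k h)) _ _ k (le1 k kt) (ege k kt).
  move=> h; apply: le_trans (h _ _) _ => {h}.
  - by move=> j /lt2 jt; rewrite addr_ge0// mulr_ge0// pge.
  - by move=> j /lt1 jt; rewrite addrA; exact: He.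
  - rewrite /Eb ler_pM2l//; apply: (sum_le_cst (ltnW kt)).
      by rewrite addr_ge0// mulr_ge0.
    move=> j jk; rewrite lerD2r; apply: ler_wpM2l => //.
    by apply: pb; exact: ltn_trans jk kt.
set W := L ^+ 2 * tau%:R ^+ 2 * x * v.
have W0 : 0 <= W by rewrite /W mulr_ge0// mulr_ge0// mulr_ge0// sqr_ge0.
have EbW : L ^+ 2 * (tau%:R * Eb) <= 2^-1 * S + 39 * W.
  set a := tau%:R ^+ 2 * x * (L * delta) in hd.
  have a0 : 0 <= a by rewrite /a !mulr_ge0 ?sqr_ge0// ltW.
  have a2 : 216 * a ^+ 2 * S <= 2^-1 * S.
    apply: ler_wpM2r => //.
    have : a ^+ 2 <= 72^-1 * 72^-1 by rewrite expr2; apply: ler_pM.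
    by lra.
  have b2 : 72 * (tau%:R ^+ 2 * x * delta ^+ 2) * W <= W.
    rewrite ler_piMl//.
    have : tau%:R ^+ 2 * x * delta ^+ 2 <= a.
      rewrite /a; apply: ler_wpM2l; first by rewrite mulr_ge0 ?sqr_ge0.
      by rewrite expr2; apply: ler_wpM2r.
    by lra.
  have -> : L ^+ 2 * (tau%:R * Eb) = 216 * a ^+ 2 * S
      + 72 * (tau%:R ^+ 2 * x * delta ^+ 2) * W + 38 * W.
    by rewrite /Eb /Pb /W /a; ring.
  by lra.
have sumE : L ^+ 2 * \sum_(0 <= k < tau) e k <= 2^-1 * S + 39 * W.
  apply: le_trans EbW; apply: ler_wpM2l; first exact: sqr_ge0.
  by apply: sum_le_cst => //; rewrite mulr_ge0// mulr_ge0// addr_ge0// mulr_ge0.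
have key k : (k < tau)%N -> Gr k <= 2 / eta * (F k - F k.+1) - 2^-1 * s k
    + L ^+ 2 * e k + L * eta * (v / n%:R).
  move=> kt; have hF := HF k kt; have sk := sge k kt.
  have hs : eta / 2 * (2^-1 * s k) <= eta / 2 * ((1 - L * eta) * s k).
    by rewrite ler_pM2l ?divr_gt0//; apply: ler_wpM2r => //; lra.
  rewrite -(ler_pM2l (divr_gt0 eta0 (ltr0Sn R 1))).
  have -> : eta / 2 * (2 / eta * (F k - F k.+1) - 2^-1 * s k + L ^+ 2 * e k
      + L * eta * (v / n%:R)) = (F k - F k.+1) - eta / 2 * (2^-1 * s k)
      + eta / 2 * L ^+ 2 * e k + L * eta ^+ 2 / 2 * (v / n%:R).
    by field; rewrite pnatr_eq0 -lt0n n0 gt_eqF.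
  by lra.
apply: (@le_trans _ _ (\sum_(0 <= k < tau) (2 / eta * (F k - F k.+1)
    - 2^-1 * s k + L ^+ 2 * e k + L * eta * (v / n%:R)))).
  by apply: ler_sum_nat => k /andP[_ kt]; exact: key.
rewrite !big_split/= -!mulr_sumr.
have -> : \sum_(0 <= i < tau) (F i - F i.+1) = F 0%N - F tau.
  rewrite -[RHS]opprB -(telescope_sumr F (leq0n tau)) -sumrN.
  by apply: eq_bigr => i _; rewrite opprB.
have -> : \sum_(0 <= i < tau) - (2^-1 * s i) = - (2^-1 * S).
  by rewrite sumrN -mulr_sumr.
rewrite sumr_const_nat subn0 -[_ *+ tau]mulr_natl.
have -> : 39 * L ^+ 2 * tau%:R ^+ 2 * x * v = 39 * W by rewrite /W; ring.
by lra.
Qed.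

End Recursions.

(** * Measurability of random vectors *)

(** Borel measurability of a vector-valued map. *)
Definition measurable_vec (R : realType) (d : nat) (dW : measure_display)
    (W : measurableType dW) (X : W -> 'rV[R]_d) : Prop :=
  measurable_fun [set: W] (X : W -> borel_rV R d).

Section MeasurableVec.
Context {R : realType} {d : nat} {dW : measure_display} {W : measurableType dW}.
Implicit Types (X Y : W -> 'rV[R]_d).

Lemma measurable_borel_coord (j : 'I_d) :
  measurable_fun [set: borel_rV R d] (fun x : borel_rV R d => x 0 j : R).
Proof.
apply: (measurability _ (RGenOpens.measurableE R)) => _ [_ [a [b ->]] <-].
rewrite setTI; apply: sub_sigma_algebra => /=.
apply: open_comp; last exact: interval_open.
by move=> x _; exact: coord_continuous.
Qed.

(** The rational boxes form a countable base of the topology, so that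
    measurability can be checked coordinate by coordinate. *)
Lemma measurable_vecP X :
  measurable_vec X <-> forall j, measurable_fun [set: W] (fun w => X w 0 j).
Proof.
split=> [mX j|mX]; first exact: (measurableT_comp (measurable_borel_coord j) mX).
rewrite /measurable_vec;
apply: (@measurability _ _ W (borel_rV R d) _ _ (@open 'rV[R]_d)) => //.
move=> _ [U oU <-].
rewrite setTI.
pose box (p : 'rV[rat]_d * nat) : set 'rV[R]_d :=
  [set x | forall j, `|x 0 j - ratr (p.1 0 j)| < p.2.+1%:R^-1].
have -> : X @^-1` U = \bigcup_(p in [set p | box p `<=` U]) (X @^-1` box p).
  apply/seteqP; split=> [w Uw|w [p pU pw]]; last exact: pU.
  have /nbhs_ballP[e /= e0 eU] : nbhs (X w) U by exact: open_nbhs_nbhs.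
  have [m me] : exists m : nat, m.+1%:R^-1 < e / 2.
    have [m hm] := ltr_add_invr (divr_gt0 e0 (ltr0Sn R 1)).
    by exists m; move: hm; rewrite add0r.
  have m0 : 0 < m.+1%:R^-1 :> R by rewrite invr_gt0.
  set r : R := m.+1%:R^-1 in me m0.
  have hq (j : 'I_d) : exists q : rat, `|X w 0 j - ratr q| < r.
    have [|q] := @rat_in_itvoo R (X w 0 j - r) (X w 0 j + r).
      by lra.
    rewrite in_itv/= => /andP[q1 q2]; exists q.
    by rewrite ltr_norml; apply/andP; split; lra.
  have [q qP] := boolp.choice hq.
  exists (\row_j q j, m); last by move=> j /=; rewrite mxE.
  move=> x /= xb; apply: eU; split => // i j; rewrite (ord1 i).
  rewrite -ball_normE /=; have := xb j; rewrite mxE -/r => h.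
  apply: (@le_lt_trans _ _
    (`|X w 0 j - ratr (q j)| + `|x 0 j - ratr (q j)|)).
    by rewrite -[X in _ <= _ + X]normrN -[leLHS](_ : `|(X w 0 j - ratr (q j))
      + - (x 0 j - ratr (q j))| = _) ?ler_normD//; congr `|_|; ring.
  by have := qP j; lra.
rewrite bigcup_mkcond; apply: countable_bigcupT_measurable => [|p].
  exact: countableP.
case: ifPn => // _.
have -> : X @^-1` box p = \big[setI/setT]_(j : 'I_d)
    (fun w => `|X w 0 j - ratr (p.1 0 j)|) @^-1` `]-oo, p.2.+1%:R^-1[.
  apply/seteqP; split=> [w /= h|w].
    by rewrite -bigcap_seq => j _ /=; rewrite in_itv/=; exact: h.
  rewrite -bigcap_seq => /= h j.
  by have := h j; rewrite /= in_itv/=; apply; rewrite mem_index_enum.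
apply: big_ind => // [A B|j _]; first exact: measurableI.
rewrite -[X in measurable X]setTI.
have : measurable_fun [set: W] (fun w => `|X w 0 j - ratr (p.1 0 j)|).
  by apply: measurableT_comp => //; apply: measurable_funB.
by apply.
Qed.

End MeasurableVec.

Section MeasurableVecOps.
Context {R : realType} {d : nat} {dW : measure_display} {W : measurableType dW}.
Implicit Types (X Y : W -> 'rV[R]_d).

Lemma measurable_vec_cst (x : 'rV[R]_d) : measurable_vec (fun _ : W => x).
Proof. by apply/measurable_vecP => j; exact: measurable_cst. Qed.

Lemma measurable_vecD X Y : measurable_vec X -> measurable_vec Y ->
  measurable_vec (fun w => X w + Y w).
Proof.
move=> /measurable_vecP mX /measurable_vecP mY; apply/measurable_vecP => j.
by under eq_fun do rewrite mxE; exact: measurable_funD.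
Qed.

Lemma measurable_vecZ (a : R) X : measurable_vec X ->
  measurable_vec (fun w => a *: X w).
Proof.
move=> /measurable_vecP mX; apply/measurable_vecP => j.
by under eq_fun do rewrite mxE; exact: measurable_funM.
Qed.

Lemma measurable_vecB X Y : measurable_vec X -> measurable_vec Y ->
  measurable_vec (fun w => X w - Y w).
Proof.
move=> mX mY; under eq_fun do rewrite -scaleN1r.
by apply: measurable_vecD => //; exact: measurable_vecZ.
Qed.

Lemma measurable_vec_sum (I : eqType) (r : seq I) (X : I -> W -> 'rV[R]_d) :
  (forall i, i \in r -> measurable_vec (X i)) ->
  measurable_vec (fun w => \sum_(i <- r) X i w).
Proof.
elim: r => [|i r IH] mX.
  by under eq_fun do rewrite big_nil; exact: measurable_vec_cst.
under eq_fun do rewrite big_cons; apply: measurable_vecD.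
  by apply: mX; rewrite mem_head.
by apply: IH => j jr; apply: mX; rewrite inE jr orbT.
Qed.

Lemma measurable_dot X Y : measurable_vec X -> measurable_vec Y ->
  measurable_fun [set: W] (fun w => dot (X w) (Y w)).
Proof.
move=> /measurable_vecP mX /measurable_vecP mY.
by apply: measurable_sum => j; exact: measurable_funM.
Qed.

Lemma measurable_sq X : measurable_vec X ->
  measurable_fun [set: W] (fun w => sq (X w)).
Proof. by move=> mX; exact: measurable_dot. Qed.

(** A map that is Lipschitz for the Euclidean norm is Borel. *)
Lemma measurable_vec_lipschitz (K : R) (g : 'rV[R]_d -> 'rV[R]_d) X :
  0 <= K -> (forall x y, sq (g x - g y) <= K ^+ 2 * sq (x - y)) ->
  measurable_vec X -> measurable_vec (fun w => g (X w)).
Proof.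
move=> K0 gK mX; apply/measurable_vecP => j.
suff cg : continuous (fun x : 'rV[R]_d => g x 0 j).
  suff mg : measurable_fun [set: borel_rV R d] (fun x : borel_rV R d => g x 0 j).
    exact: (measurableT_comp mg mX).
  apply: (measurability _ (RGenOpens.measurableE R)) => _ [_ [a [b ->]] <-].
  rewrite setTI; apply: sub_sigma_algebra => /=.
  apply: open_comp; last exact: interval_open.
  by move=> x _; exact: cg.
move=> x B /= /(nbhs_ballP (g x 0 j)) [e /= e0 eB].
pose c : R := K * d%:R + 1.
have c0 : 0 < c by rewrite ltr_wpDl// mulr_ge0.
apply/nbhs_ballP; exists (e / (2 * c)) => /=.
  by rewrite divr_gt0// mulr_gt0.
move=> y [_ xy]; apply: eB; rewrite -ball_normE /=.
have r0 : 0 < e / (2 * c) by rewrite divr_gt0// mulr_gt0.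
have cr : c * (e / (2 * c)) = e / 2 by field; rewrite gt_eqF.
move: (e / (2 * c)) => r in xy r0 cr.
have h1 : sq (x - y) <= d%:R * r ^+ 2.
  apply: (@le_trans _ _ (\sum_(k < d) r ^+ 2)); last first.
    by rewrite sumr_const card_ord -[_ *+ d]mulr_natl.
  apply: ler_sum => k _; rewrite -expr2 !mxE -[leLHS]real_normK ?num_real//.
  apply: lerXn2r; rewrite ?nnegrE ?normr_ge0 ?(ltW r0)//.
  by have := xy 0 k; rewrite -ball_normE /= => /ltW.
have h2 : `|g x 0 j - g y 0 j| ^+ 2 <= (c * r) ^+ 2.
  rewrite real_normK ?num_real//.
  have := coord_sqr_le (g x - g y) j; rewrite !mxE => /le_trans; apply.
  apply: le_trans (gK x y) _; apply: le_trans (ler_wpM2l (sqr_ge0 K) h1) _.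
  rewrite exprMn mulrA; apply: ler_wpM2r; first exact: sqr_ge0.
  have dd : d%:R <= d%:R ^+ 2 :> R.
    rewrite -natrX ler_nat; case: (d) => // k.
    by rewrite -{1}(expn1 k.+1) leq_pexp2l.
  apply: le_trans (ler_wpM2l (sqr_ge0 K) dd) _; rewrite -exprMn.
  by apply: lerXn2r; rewrite ?nnegrE ?mulr_ge0 ?(ltW c0)// lerDl.
move: h2; rewrite ler_sqr ?nnegrE ?normr_ge0 ?mulr_ge0 ?(ltW c0) ?(ltW r0)//.
move=> h2.
apply: le_lt_trans h2 _; rewrite cr.
by rewrite ltr_pdivrMr//; lra.
Qed.

End MeasurableVecOps.

(** * Expectations and square-integrable random vectors *)

Section Expectation.
Context {R : realType} {dO : measure_display} {Om : measurableType dO}.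
Variable P : probability Om R.
Implicit Types (h g : Om -> R).

(** Integrability of a real random variable. *)
Definition integrable_rv h : Prop := P.-integrable [set: Om] (EFin \o h).

(** The real-valued expectation, meaningful for integrable variables. *)
Definition Ex h : R := \int[P]_w h w.

Lemma ExE h : integrable_rv h -> 'E_P[h]%E = (Ex h)%:E.
Proof.
move=> ih; rewrite unlock /Ex /Rintegral fineK//.
exact: integrable_fin_num.
Qed.

Lemma integrable_rv_cst (c : R) : integrable_rv (fun=> c).
Proof. exact: finite_measure_integrable_cst. Qed.

Lemma integrable_rvD h g : integrable_rv h -> integrable_rv g ->
  integrable_rv (fun w => h w + g w).
Proof. by move=> ih ig; exact: (integrableD measurableT ih ig). Qed.

Lemma integrable_rvZ (a : R) h : integrable_rv h ->
  integrable_rv (fun w => a * h w).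
Proof. by move=> ih; exact: (integrableZl measurableT a ih). Qed.

Lemma integrable_rvN h : integrable_rv h -> integrable_rv (fun w => - h w).
Proof.
by move=> ih; under eq_fun do rewrite -mulN1r; exact: integrable_rvZ.
Qed.

Lemma integrable_rvB h g : integrable_rv h -> integrable_rv g ->
  integrable_rv (fun w => h w - g w).
Proof. by move=> ih ig; apply: integrable_rvD => //; exact: integrable_rvN. Qed.

Lemma integrable_rv_sum (I : eqType) (r : seq I) (h : I -> Om -> R) :
  (forall i, i \in r -> integrable_rv (h i)) ->
  integrable_rv (fun w => \sum_(i <- r) h i w).
Proof.
elim: r => [|i r IH] mX.
  by under eq_fun do rewrite big_nil; exact: integrable_rv_cst.
under eq_fun do rewrite big_cons; apply: integrable_rvD.
  by apply: mX; rewrite mem_head.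
by apply: IH => j jr; apply: mX; rewrite inE jr orbT.
Qed.

Lemma integrable_rv_le h g : measurable_fun [set: Om] h ->
  (forall w, `|h w| <= g w) -> integrable_rv g -> integrable_rv h.
Proof.
move=> mh hg ig; apply: (le_integrable measurableT _ _ ig).
  exact/measurable_EFinP.
by move=> w _ /=; rewrite lee_fin (le_trans (hg w))// ler_norm.
Qed.

Lemma ExD h g : integrable_rv h -> integrable_rv g ->
  Ex (fun w => h w + g w) = Ex h + Ex g.
Proof. by move=> ih ig; exact: RintegralD. Qed.

Lemma ExZ (a : R) h : integrable_rv h -> Ex (fun w => a * h w) = a * Ex h.
Proof. by move=> ih; exact: RintegralZl. Qed.

Lemma ExB h g : integrable_rv h -> integrable_rv g ->
  Ex (fun w => h w - g w) = Ex h - Ex g.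
Proof. by move=> ih ig; exact: RintegralB. Qed.

Lemma Ex_cst (c : R) : Ex (fun=> c) = c.
Proof. apply: EFin_inj; rewrite -ExE; last exact: integrable_rv_cst.
exact: expectation_cst. Qed.

Lemma Ex_sum (I : eqType) (r : seq I) (h : I -> Om -> R) :
  (forall i, i \in r -> integrable_rv (h i)) ->
  Ex (fun w => \sum_(i <- r) h i w) = \sum_(i <- r) Ex (h i).
Proof.
elim: r => [|i r IH] mX.
  by under [X in Ex X]eq_fun do rewrite big_nil; rewrite Ex_cst big_nil.
under [X in Ex X]eq_fun do rewrite big_cons; rewrite ExD ?big_cons ?IH//.
- by move=> j jr; apply: mX; rewrite inE jr orbT.
- by apply: mX; rewrite mem_head.
- by apply: integrable_rv_sum => j jr; apply: mX; rewrite inE jr orbT.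
Qed.

Lemma Ex_le h g : integrable_rv h -> integrable_rv g ->
  (forall w, h w <= g w) -> Ex h <= Ex g.
Proof. by move=> ih ig hg; apply: le_Rintegral. Qed.

Lemma Ex_ge0 h : (forall w, 0 <= h w) -> 0 <= Ex h.
Proof. by move=> h0; apply: Rintegral_ge0. Qed.

Context {d : nat}.
Implicit Types (X Y : Om -> 'rV[R]_d).

(** Square-integrable random vectors. *)
Definition L2vec X : Prop :=
  measurable_vec X /\ integrable_rv (fun w => sq (X w)).

Lemma L2vec_le X h : measurable_vec X -> (forall w, sq (X w) <= h w) ->
  integrable_rv h -> L2vec X.
Proof.
move=> mX Xh ih; split=> //; apply: (integrable_rv_le _ _ ih).
  exact: measurable_sq.
by move=> w; rewrite ger0_norm ?sq_ge0.
Qed.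

Lemma L2vec_cst (x : 'rV[R]_d) : L2vec (fun=> x).
Proof. by split; [exact: measurable_vec_cst|exact: integrable_rv_cst]. Qed.

Lemma L2vecD X Y : L2vec X -> L2vec Y -> L2vec (fun w => X w + Y w).
Proof.
move=> [mX iX] [mY iY].
apply: (L2vec_le (measurable_vecD mX mY) (fun w => sqD_le (X w) (Y w))).
by apply: integrable_rvD; exact: integrable_rvZ.
Qed.

Lemma L2vecZ (a : R) X : L2vec X -> L2vec (fun w => a *: X w).
Proof.
move=> [mX iX]; split; first exact: measurable_vecZ.
by under eq_fun do rewrite sqZ; exact: integrable_rvZ.
Qed.

Lemma L2vecB X Y : L2vec X -> L2vec Y -> L2vec (fun w => X w - Y w).
Proof.
move=> lX lY; under eq_fun do rewrite -scaleN1r.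
by apply: L2vecD => //; exact: L2vecZ.
Qed.

Lemma L2vec_sum (I : eqType) (r : seq I) (X : I -> Om -> 'rV[R]_d) :
  (forall i, i \in r -> L2vec (X i)) -> L2vec (fun w => \sum_(i <- r) X i w).
Proof.
elim: r => [|i r IH] mX.
  by under eq_fun do rewrite big_nil; exact: L2vec_cst.
under eq_fun do rewrite big_cons; apply: L2vecD.
  by apply: mX; rewrite mem_head.
by apply: IH => j jr; apply: mX; rewrite inE jr orbT.
Qed.

Lemma L2vec_mean (n : nat) (X : 'I_n -> Om -> 'rV[R]_d) :
  (forall i, L2vec (X i)) -> L2vec (fun w => mean (X^~ w)).
Proof. by move=> lX; apply: L2vecZ; apply: L2vec_sum => i _. Qed.

Lemma integrable_dot X Y : L2vec X -> L2vec Y ->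
  integrable_rv (fun w => dot (X w) (Y w)).
Proof.
move=> [mX iX] [mY iY].
apply: (@integrable_rv_le _ (fun w => sq (X w) + sq (Y w))).
- exact: measurable_dot.
- move=> w; have h1 := dot_young (X w) (Y w) (@ltr01 R).
  have h2 := dot_young (- X w) (Y w) (@ltr01 R).
  move: h1 h2; rewrite dotNl sqN invr1 !mul1r.
  have := sq_ge0 (X w); have := sq_ge0 (Y w).
  by move=> a b c e; rewrite ler_norml; apply/andP; split; lra.
- exact: integrable_rvD.
Qed.

Lemma L2vec_lipschitz (K : R) (g : 'rV[R]_d -> 'rV[R]_d) X :
  0 <= K -> (forall x y, sq (g x - g y) <= K ^+ 2 * sq (x - y)) ->
  L2vec X -> L2vec (fun w => g (X w)).
Proof.
move=> K0 gK [mX iX].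
apply: (@L2vec_le _ (fun w => 2 * (K ^+ 2 * sq (X w)) + 2 * sq (g 0))).
- exact: measurable_vec_lipschitz gK mX.
- move=> w; rewrite -{1}(subrK (g 0) (g (X w))).
  apply: le_trans (sqD_le _ _) _; rewrite lerD2r ler_pM2l//.
  by apply: le_trans (gK _ _) _; rewrite subr0.
- apply: integrable_rvD; last exact: integrable_rv_cst.
  by apply: integrable_rvZ; exact: integrable_rvZ.
Qed.

(** Pythagoras' identity for a vector and an orthogonal noise. *)
Lemma Ex_sqB (a : R) X Y : L2vec X -> L2vec Y ->
  Ex (fun w => dot (X w) (Y w)) = 0 ->
  Ex (fun w => sq (X w - a *: Y w)) =
  Ex (fun w => sq (X w)) + a ^+ 2 * Ex (fun w => sq (Y w)).
Proof.
move=> lX lY XY.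
have iXY := integrable_dot lX lY.
under [X in Ex X = _]eq_fun do rewrite sqB dotZr sqZ mulrA.
rewrite ExD ?ExB ?ExZ ?XY ?mulr0 ?subr0//; [exact: lY.2|exact: lX.2| | |].
- exact: integrable_rvZ.
- by apply: integrable_rvB; [exact: lX.2|exact: integrable_rvZ].
- by apply: integrable_rvZ; exact: lY.2.
Qed.

End Expectation.

(** * Freezing an independent sample *)

(** The change of variables formula needs no integrability: both sides are
    differences of the integrals of the positive and negative parts. *)
Lemma integral_pushforwardT (R : realType) (d1 d2 : measure_display)
    (T1 : measurableType d1) (T2 : measurableType d2)
    (mu : {measure set T1 -> \bar R}) (V : T1 -> T2)
    (mV : measurable_fun setT V) (g : T2 -> \bar R) : measurable_fun setT g ->
  (\int[pushforward mu V]_y g y = \int[mu]_x g (V x))%E.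
Proof.
move=> mg; rewrite [LHS]integralE [RHS]integralE.
have mp := measurable_funepos mg; have mn := measurable_funeneg mg.
have gp : {in setT, forall y, (0 <= g^\+ y)%E} by [].
have gn : {in setT, forall y, (0 <= g^\- y)%E} by [].
rewrite (ge0_integral_pushforward mV mu measurableT mp gp).
rewrite (ge0_integral_pushforward mV mu measurableT mn gn).
rewrite preimage_setT; congr (_ - _)%E; apply: eq_integral => x _.
  by rewrite /= !funeposE.
by rewrite /= !funenegE.
Qed.

Section Freezing.
Local Open Scope ereal_scope.
Context {R : realType} {dO d1 d2 : measure_display} {Om : measurableType dO}.
Context {T1 : measurableType d1} {T2 : measurableType d2}.
Variables (P : probability Om R) (U : Om -> T1) (V : Om -> T2).
Hypotheses (mU : measurable_fun setT U) (mV : measurable_fun setT V).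
Hypothesis UV : forall A B, measurable A -> measurable B ->
  P (U @^-1` A `&` V @^-1` B) = P (U @^-1` A) * P (V @^-1` B).

Let Um : {mfun Om >-> T1} := HB.pack U (isMeasurableFun.Build _ _ _ _ _ mU).
Let Vm : {mfun Om >-> T2} := HB.pack V (isMeasurableFun.Build _ _ _ _ _ mV).

Let W (w : Om) : T1 * T2 := (U w, V w).
Let mW : measurable_fun setT W. Proof. exact: measurable_fun_pair. Qed.
Let Wm : {mfun Om >-> (T1 * T2)%type} :=
  HB.pack W (isMeasurableFun.Build _ _ _ _ _ mW).

Let joint (X : set (T1 * T2)) : measurable X ->
  (distribution P Um \x distribution P Vm) X = distribution P Wm X.
Proof. by apply: product_measure_unique => A B mA mB; exact: UV. Qed.

(** Expectations of functions of two independent variables are computed by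
    integrating over the second one with the first one frozen. *)
Lemma ge0_freezing (phi : T1 * T2 -> \bar R) : measurable_fun setT phi ->
  (forall z, 0 <= phi z) ->
  \int[P]_w phi (U w, V w) = \int[P]_w \int[P]_v phi (U w, V v).
Proof.
move=> mphi phi0.
transitivity (\int[distribution P Wm]_z phi z).
  by rewrite ge0_integral_pushforward// => z _; exact: phi0.
transitivity (\int[distribution P Um \x distribution P Vm]_z phi z).
  by apply: eq_measure_integral => A mA _; exact/esym/joint.
rewrite fubini_tonelli1//.
have mF : measurable_fun setT (fubini_F (distribution P Vm) phi).
  exact: measurable_fun_fubini_tonelli_F.
have F0 z : 0 <= fubini_F (distribution P Vm) phi z.
  by apply: integral_ge0 => v _; exact: phi0.
rewrite [LHS](ge0_integral_pushforward mU P measurableT mF (fun z _ => F0 z)).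
apply: eq_integral => w _; rewrite /= /fubini_F.
have mphi1 : measurable_fun setT (fun y => phi (U w, y)).
  exact: measurableT_comp.
by rewrite [LHS](ge0_integral_pushforward mV P measurableT mphi1).
Qed.

Lemma freezing (phi : T1 * T2 -> \bar R) : measurable_fun setT phi ->
  P.-integrable setT (fun w => phi (U w, V w)) ->
  \int[P]_w phi (U w, V w) = \int[P]_w \int[P]_v phi (U w, V v).
Proof.
move=> mphi iphi.
have iW : (distribution P Wm).-integrable setT phi.
  exact: integrable_pushforward.
have iprod : (distribution P Um \x distribution P Vm).-integrable setT phi.
  apply/integrableP; split=> //.
  case/integrableP: iW => _; apply: le_lt_trans.
  by rewrite le_eqVlt; apply/orP; left; apply/eqP; apply: eq_measure_integral
    => A mA _; exact: joint.
transitivity (\int[distribution P Wm]_z phi z).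
  by rewrite [RHS](integral_pushforwardT P mW).
transitivity (\int[distribution P Um \x distribution P Vm]_z phi z).
  by apply: eq_measure_integral => A mA _; exact/esym/joint.
rewrite -integral12_prod_meas1//.
have mF : measurable_fun setT (fubini_F (distribution P Vm) phi).
  exact: measurable_fubini_F iprod.
rewrite [LHS](integral_pushforwardT P mU mF).
apply: eq_integral => w _; rewrite /fubini_F.
have mphi1 : measurable_fun setT (fun y => phi (U w, y)).
  exact: measurableT_comp.
by rewrite [LHS](integral_pushforwardT P mV mphi1).
Qed.

End Freezing.

(** * The sigma-algebra of a set of samples *)

Section Samples.
Context {R : realType} {dO dX : measure_display} {Om : measurableType dO}.
Variables (P : probability Om R) (I : finType) (Xi : I -> measurableType dX).
Variable xi : forall k : I, Om -> Xi k.
Implicit Types (J : {set I}).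

(** Events prescribing measurable constraints on the samples in [J]: a
    pi-system. *)
Definition sample_rects J : set (set Om) :=
  [set B | exists A : forall k, set (Xi k), (forall k, measurable (A k)) /\
     B = \bigcap_(k in [set` J]) (xi k @^-1` A k)].

(** The sample space equipped with the sigma-algebra generated by the samples
    in [J]. *)
Definition sample_space J := g_sigma_algebraType (sample_rects J).

Lemma sample_rectsT J : sample_rects J setT.
Proof.
by exists (fun k => setT); split=> //; rewrite bigcapT.
Qed.

Lemma sample_rectsI J : setI_closed (sample_rects J).
Proof.
move=> _ _ [A [mA ->]] [B [mB ->]]; exists (fun k => A k `&` B k); split.
  by move=> k; exact: measurableI.
by rewrite -bigcapI; apply: eq_bigcapr => k _; rewrite preimage_setI.
Qed.

(** The constraint [A] on the sample [k], transported along [k = l], and none on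
    the other samples. *)
Definition single_constraint (k : I) (A : set (Xi k)) (l : I) : set (Xi l) :=
  if pselect (k = l) is left e then ecast z (set (Xi z)) e A else setT.
Arguments single_constraint {k} A l.

Lemma single_constraintE (k : I) (A : set (Xi k)) : single_constraint A k = A.
Proof.
rewrite /single_constraint; case: pselect => // e.
by rewrite (Prop_irrelevance e erefl).
Qed.

Lemma single_constraintN (k l : I) (A : set (Xi k)) : k != l ->
  single_constraint A l = setT.
Proof.
by rewrite /single_constraint; case: pselect => // e /eqP.
Qed.

Lemma measurable_single_constraint (k : I) (A : set (Xi k)) : measurable A ->
  forall l, measurable (single_constraint A l).
Proof.
move=> mA l; have [e|kl] := eqVneq k l; last by rewrite single_constraintN.
by subst l; rewrite single_constraintE.
Qed.

Lemma measurable_sample J (k : I) : k \in J ->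
  measurable_fun setT (xi k : sample_space J -> Xi k).
Proof.
move=> kJ _ A mA; rewrite setTI; apply: sub_sigma_algebra.
exists (single_constraint A); split; first exact: measurable_single_constraint.
apply/seteqP; split=> [w Aw l lJ|w /(_ k kJ)]; last first.
  by rewrite /preimage/= single_constraintE.
have [e|kl] := eqVneq k l; last by rewrite single_constraintN.
by subst l; rewrite single_constraintE.
Qed.

Lemma sample_rects_mono J J' : J \subset J' ->
  sample_rects J `<=` sample_rects J'.
Proof.
move=> JJ' _ [A [mA ->]].
exists (fun k => if k \in J then A k else setT); split.
  by move=> k; case: ifP.
apply/seteqP; split=> w /= h k kJ; last first.
  by have := h k (fintype.subsetP JJ' _ kJ); rewrite /preimage/= kJ.
by rewrite /preimage/=; case: ifPn => // kJ'; exact: h.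
Qed.

Lemma measurable_sample_mono J J' (d2 : measure_display)
    (T2 : measurableType d2) (X : Om -> T2) : J \subset J' ->
  measurable_fun setT (X : sample_space J -> T2) ->
  measurable_fun setT (X : sample_space J' -> T2).
Proof.
move=> JJ' mX _ A mA; rewrite setTI.
have := mX measurableT A mA; rewrite setTI.
exact: (sub_sigma_algebra2 (sample_rects_mono JJ')).
Qed.

Hypothesis mxi : forall k, measurable_fun setT (xi k).

Lemma sample_rects_measurable J : sample_rects J `<=` measurable.
Proof.
move=> _ [A [mA ->]]; apply: fin_bigcap_measurable.
  exact: finite_finset.
move=> k _; rewrite -[X in measurable X]setTI.
exact: (mxi measurableT (mA k)).
Qed.

Lemma sample_space_sub J (B : set Om) :
  measurable (B : set (sample_space J)) -> measurable B.
Proof. exact: (smallest_sub (@sigma_algebra_measurable _ Om)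
  (@sample_rects_measurable J)). Qed.

Lemma measurable_sample_sub J (d2 : measure_display)
    (T2 : measurableType d2) (X : Om -> T2) :
  measurable_fun setT (X : sample_space J -> T2) -> measurable_fun setT X.
Proof.
move=> mX _ A mA; rewrite setTI; apply: (@sample_space_sub J).
by have := mX measurableT A mA; rewrite setTI.
Qed.

Hypothesis indep : mutually_independent P xi.

Lemma sample_indep J (k : I) : k \notin J ->
  forall (B : set (sample_space J)) (A : set (Xi k)),
  measurable B -> measurable A ->
  P ((B : set Om) `&` xi k @^-1` A) = (P B * P (xi k @^-1` A))%E.
Proof.
move=> kJ B A mB mA.
have mkA : measurable (xi k @^-1` A).
  by rewrite -[X in measurable X]setTI; apply: mxi.
pose p : {nonneg R} := NngNum (fine_ge0 (measure_ge0 P (xi k @^-1` A))).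
have pE : (p%:num%:E = P (xi k @^-1` A))%E.
  by rewrite /= fineK// fin_num_measure.
have key : forall E, <<s sample_rects J >> E ->
    mrestr P mkA E = mscale p P E.
  apply: (g_sigma_algebra_measure_unique (sample_rects J)
    (@sample_rects_measurable J) (fun=> setT)).
  - by move=> i; exact: sample_rectsT.
  - by rewrite bigcup_const//; exists 0%N.
  - exact: sample_rectsI.
  - move=> _ [C [mC ->]].
    pose D l : set (Xi l) := if l \in J then C l else single_constraint A l.
    have mD l : measurable (D l).
      by rewrite /D; case: ifP => // _; exact: measurable_single_constraint.
    have Dk : D k = A by rewrite /D (negbTE kJ) single_constraintE.
    have DJ l : l \in J -> D l = C l by rewrite /D => ->.
    have := indep (k |: J) mD.
    have -> : \bigcap_(l in [set` k |: J]) (xi l @^-1` D l) =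
        (\bigcap_(l in [set` J]) (xi l @^-1` C l)) `&` xi k @^-1` A.
      apply/seteqP; split=> [w /= h|w /= [h1 h2] l].
        split=> [l lJ|]; last by rewrite -Dk; apply: h; rewrite /= !inE eqxx.
        by rewrite -DJ//; apply: h; rewrite /= !inE lJ orbT.
      rewrite /= !inE => /orP[/eqP->|lJ]; first by rewrite Dk.
      by rewrite DJ//; exact: h1.
    rewrite big_setU1//= Dk /mrestr => ->.
    rewrite /mscale pE; congr (_ * _)%E.
    rewrite [RHS](indep J mC).
    have E l : l \in J -> P (xi l @^-1` D l) = P (xi l @^-1` C l).
      by move=> lJ; rewrite DJ.
    exact: (eq_bigr _ E).
  - move=> _; rewrite -ge0_fin_numE; last exact: measure_ge0.
    by rewrite /= /mrestr setTI fin_num_measure.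
have := key B mB; rewrite /mrestr/= /mscale pE => ->.
by rewrite muleC.
Qed.

End Samples.

(** * Noise of an oracle queried at an independent point *)

Section OracleNoise.
Context {R : realType} {d : nat} {dO dU dS : measure_display}.
Context {Om : measurableType dO} {S : measurableType dS} {T : measurableType dU}.
Variables (P : probability Om R) (U : Om -> T) (s : Om -> S).
Hypotheses (mU : measurable_fun setT U) (ms : measurable_fun setT s).
Hypothesis Us : forall A B, measurable A -> measurable B ->
  P (U @^-1` A `&` s @^-1` B) = (P (U @^-1` A) * P (s @^-1` B))%E.
Variables (g : 'rV[R]_d -> S -> 'rV[R]_d) (m : 'rV[R]_d -> 'rV[R]_d).
Variables (K sigma : R).
Hypothesis mg : measurable_fun setT
  (fun p : borel_rV R d * S => g p.1 p.2 : borel_rV R d).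
Hypothesis K_ge0 : 0 <= K.
Hypothesis m_lip : forall x y, sq (m x - m y) <= K ^+ 2 * sq (x - y).
Hypothesis g_mean : forall x j, 'E_P[fun w => (g x (s w) 0 j)%R]%E = (m x 0 j)%:E.
Hypothesis g_var : forall x,
  ('E_P[fun w => (norm2 (g x (s w) - m x) ^+ 2)%R] <= (sigma ^+ 2)%:E)%E.

Lemma measurable_oracle (dW : measure_display) (W : measurableType dW)
    (X : W -> 'rV[R]_d) (r : W -> S) :
  measurable_vec X -> measurable_fun setT r ->
  measurable_vec (fun w => g (X w) (r w)).
Proof.
move=> mX mr; rewrite /measurable_vec.
exact: (measurableT_comp mg (measurable_fun_pair mX mr)).
Qed.

Lemma measurable_noise (dW : measure_display) (W : measurableType dW)
    (X : W -> 'rV[R]_d) (r : W -> S) :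
  measurable_vec X -> measurable_fun setT r ->
  measurable_vec (fun w => g (X w) (r w) - m (X w)).
Proof.
move=> mX mr; apply: measurable_vecB; first exact: measurable_oracle.
exact: measurable_vec_lipschitz m_lip mX.
Qed.

Let integral_sq_le (X : Om -> 'rV[R]_d) (c : R) : measurable_vec X ->
  (\int[P]_w (sq (X w))%:E <= c%:E)%E ->
  L2vec P X /\ Ex P (fun w => sq (X w)) <= c.
Proof.
move=> mX Xc.
have iX : integrable_rv P (fun w => sq (X w)).
  apply/integrableP; split; first exact/measurable_EFinP/measurable_sq.
  under eq_integral => w _ do rewrite /= ger0_norm ?sq_ge0//.
  exact: le_lt_trans Xc (ltry c).
by split=> //; rewrite -lee_fin -ExE// unlock.
Qed.

(** At a deterministic point the noise is square-integrable with mean zero. *)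
Lemma frozen_noise (x : 'rV[R]_d) (v : 'rV[R]_d) :
  L2vec P (fun w => g x (s w) - m x) /\
  Ex P (fun w => dot v (g x (s w) - m x)) = 0.
Proof.
have mz : measurable_vec (fun w => g x (s w) - m x).
  exact: (measurable_noise (measurable_vec_cst x)).
have [lz _] : L2vec P (fun w => g x (s w) - m x) /\
    Ex P (fun w => sq (g x (s w) - m x)) <= sigma ^+ 2.
  apply: integral_sq_le => //; have := g_var x; rewrite unlock.
  by under eq_integral => w _ do rewrite norm2_sqr.
split=> //.
have ij j : integrable_rv P (fun w => g x (s w) 0 j - m x 0 j).
  have := integrable_dot lz (L2vec_cst P (delta_mx 0 j)).
  have -> //: (fun w => dot (g x (s w) - m x) (delta_mx 0 j)) =
    (fun w => g x (s w) 0 j - m x 0 j).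
  apply/funext => w; rewrite /dot (bigD1 j)//= !mxE !eqxx/= mulr1 big1 ?addr0//.
  by move=> k kj; rewrite !mxE (negbTE kj) andbF mulr0.
have zj j : Ex P (fun w => g x (s w) 0 j - m x 0 j) = 0.
  have h := ExD (ij j) (integrable_rv_cst P (m x 0 j)).
  have ig : integrable_rv P (fun w => g x (s w) 0 j).
    have := integrable_rvD (ij j) (integrable_rv_cst P (m x 0 j)).
    by under eq_fun do rewrite subrK.
  move: h; under [X in Ex P X = _]eq_fun do rewrite subrK.
  rewrite Ex_cst => h.
  have : Ex P (fun w => g x (s w) 0 j) = m x 0 j.
    by apply: EFin_inj; rewrite -ExE.
  by rewrite h => /eqP; rewrite -subr_eq0 addrK => /eqP.
have E j : (fun w => v 0 j * (g x (s w) - m x) 0 j) =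
    (fun w => v 0 j * (g x (s w) 0 j - m x 0 j)).
  by apply/funext => w; rewrite !mxE.
rewrite /dot Ex_sum => [|j _]; last by rewrite E; exact: integrable_rvZ.
by apply: big1 => j _; rewrite E ExZ ?zj ?mulr0.
Qed.

Variable X : T -> 'rV[R]_d.
Hypothesis mX : measurable_vec X.

(** The error of the oracle at the point [X (U w)], a function of [U w] and hence
    independent of the sample [s w]. *)
Definition oracle_noise (w : Om) := g (X (U w)) (s w) - m (X (U w)).

Lemma oracle_noise_L2 :
  L2vec P oracle_noise /\ Ex P (fun w => sq (oracle_noise w)) <= sigma ^+ 2.
Proof.
have mXU : measurable_vec (X \o U) by exact: (measurableT_comp mX mU).
apply: integral_sq_le.
  exact: (measurable_noise mXU ms).
pose phi (z : T * S) := (sq (g (X z.1) z.2 - m (X z.1)))%:E.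
have mphi : measurable_fun setT phi.
  apply/measurable_EFinP; apply: measurable_sq.
  apply: (@measurable_noise _ _ (X \o fst) snd) => //.
  exact: (measurableT_comp mX).
rewrite (ge0_freezing mU ms Us mphi); last by move=> z; rewrite lee_fin sq_ge0.
apply: (@le_trans _ _ (\int[P]_w (sigma ^+ 2)%:E)%E); last first.
  by rewrite integral_cst//= probability_setT mule1.
pose psi (z : T * Om) := phi (z.1, s z.2).
have mpsi : measurable_fun setT psi.
  apply: measurableT_comp => //; apply: measurable_fun_pair => //.
  exact: measurableT_comp.
have psi0 z : (0 <= psi z)%E by rewrite lee_fin sq_ge0.
have mF := measurable_fun_fubini_tonelli_F (m2 := P) psi mpsi psi0.
apply: ge0_le_integral => //.
- by move=> w _; apply: integral_ge0 => v _; rewrite lee_fin sq_ge0.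
- exact: (measurableT_comp mF mU).
- move=> w _; have := g_var (X (U w)); rewrite unlock.
  by under eq_integral => v _ do rewrite norm2_sqr.
Qed.

Lemma oracle_noise_orth (V : T -> 'rV[R]_d) :
  measurable_vec V -> L2vec P (V \o U) ->
  Ex P (fun w => dot (V (U w)) (oracle_noise w)) = 0.
Proof.
move=> mV lV; have [lz _] := oracle_noise_L2.
have iVz := integrable_dot lV lz.
pose phi (z : T * S) := (dot (V z.1) (g (X z.1) z.2 - m (X z.1)))%:E.
have mphi : measurable_fun setT phi.
  apply/measurable_EFinP; apply: measurable_dot.
    exact: (measurableT_comp mV).
  apply: (@measurable_noise _ _ (X \o fst) snd) => //.
  exact: (measurableT_comp mX).
apply: EFin_inj; rewrite -ExE// unlock.
rewrite (freezing mU ms Us mphi)//.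
under eq_integral => w _.
  have [l0 e0] := frozen_noise (X (U w)) (V (U w)).
  have i0 := integrable_dot (L2vec_cst P (V (U w))) l0.
  have := ExE i0; rewrite unlock e0 /phi /= => ->.
  over.
by rewrite integral0.
Qed.

End OracleNoise.

(** * Adapted iterates and orthogonality of the noise *)

Section Trajectory.
Context {R : realType} {n d T : nat} {dO dX : measure_display}.
Context {Om : measurableType dO}.
Variables (P : probability Om R) (Xi : 'I_n -> measurableType dX).
Variables (L sigma : R) (f : 'I_n -> 'rV[R]_d -> R).
Variables (G : forall i : 'I_n, 'rV[R]_d -> Xi i -> 'rV[R]_d).
Variables (xi : forall i : 'I_n, nat -> Om -> Xi i).
Arguments xi : clear implicits.
Hypothesis so : stochastic_oracle T sigma f P G xi.
Hypotheses (L_gt0 : 0 < L) (f_smooth : forall i, smooth L (f i)).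
Variable x : nat -> 'I_n -> Om -> 'rV[R]_d.

Notation index := ('I_T * 'I_n)%type.

Let xiI (k : index) : Om -> Xi k.2 := xi k.2 k.1.

(** The sigma-algebra generated by the samples in [J]. *)
Notation samples J := (sample_space xiI J).

(** The samples drawn before time [t]. *)
Definition before (t : nat) : {set index} := [set k : index | (k.1 < t)%N].

(** Square-integrable vectors determined by the samples drawn before [t]. *)
Definition adapted (t : nat) (X : Om -> 'rV[R]_d) : Prop :=
  measurable_vec (X : samples (before t) -> 'rV[R]_d) /\ L2vec P X.

Lemma adapted_le (s t : nat) X : (s <= t)%N -> adapted s X -> adapted t X.
Proof.
move=> st [mX lX]; split=> //; apply: measurable_sample_mono mX.
by apply/fintype.subsetP => k; rewrite !inE => /leq_trans; apply.
Qed.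

Lemma adapted_cst t (v : 'rV[R]_d) : adapted t (fun=> v).
Proof. by split; [exact: measurable_vec_cst|exact: L2vec_cst]. Qed.

Lemma adaptedD t X Y : adapted t X -> adapted t Y ->
  adapted t (fun w => X w + Y w).
Proof.
by move=> [mX lX] [mY lY]; split; [exact: measurable_vecD|exact: L2vecD].
Qed.

Lemma adaptedB t X Y : adapted t X -> adapted t Y ->
  adapted t (fun w => X w - Y w).
Proof.
by move=> [mX lX] [mY lY]; split; [exact: measurable_vecB|exact: L2vecB].
Qed.

Lemma adaptedZ t (a : R) X : adapted t X -> adapted t (fun w => a *: X w).
Proof. by move=> [mX lX]; split; [exact: measurable_vecZ|exact: L2vecZ]. Qed.

Lemma adapted_sum t (I : eqType) (r : seq I) (X : I -> Om -> 'rV[R]_d) :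
  (forall i, i \in r -> adapted t (X i)) ->
  adapted t (fun w => \sum_(i <- r) X i w).
Proof.
move=> aX; split; last by apply: L2vec_sum => i /aX[].
by apply: (measurable_vec_sum (W := samples (before t))) => i /aX[].
Qed.

Lemma adapted_mean t (X : 'I_n -> Om -> 'rV[R]_d) :
  (forall i, adapted t (X i)) -> adapted t (fun w => mean (X^~ w)).
Proof. by move=> aX; apply: adaptedZ; apply: adapted_sum => i _. Qed.

Lemma adapted_lipschitz t (K : R) (g : 'rV[R]_d -> 'rV[R]_d) X :
  0 <= K -> (forall x y, sq (g x - g y) <= K ^+ 2 * sq (x - y)) ->
  adapted t X -> adapted t (fun w => g (X w)).
Proof.
move=> K0 gK [mX lX]; split; last exact: L2vec_lipschitz gK lX.
exact: measurable_vec_lipschitz gK mX.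
Qed.

Let f_lip i (u v : 'rV[R]_d) :
  sq (grad (f i) u - grad (f i) v) <= L ^+ 2 * sq (u - v).
Proof. by apply: smooth_sq => //; exact: ltW. Qed.

Lemma adapted_grad t i X : adapted t X ->
  adapted t (fun w => grad (f i) (X w)).
Proof. by apply: adapted_lipschitz (f_lip i); exact: ltW. Qed.

Let mxiI (k : index) : measurable_fun setT (xiI k).
Proof. exact: (oracle_measurable so). Qed.

Let mG i : measurable_fun setT
  (fun p : borel_rV R d * Xi i => G p.1 p.2 : borel_rV R d).
Proof. exact: (oracle_borel so). Qed.

Let indep : mutually_independent P xiI.
Proof. exact: (oracle_independent so). Qed.

Let mid J : measurable_fun setT (id : Om -> samples J).
Proof.
apply: (measurable_sample_sub mxiI (J := J) (T2 := samples J)).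
exact: measurable_id.
Qed.

(** The error of the stochastic gradient of worker [i] at time [t]. *)
Definition noise (t : nat) (i : 'I_n) (w : Om) : 'rV[R]_d :=
  G (x t i w) (xi i t w) - grad (f i) (x t i w).

Section OneSample.
Variables (t : nat) (i : 'I_n).
Hypotheses (tT : (t < T)%N) (ax : adapted t (x t i)).

Let k : index := (Ordinal tT, i).

Let indep_k (J : {set index}) : k \notin J ->
  forall (A : set (samples J)) (B : set (Xi i)), measurable A -> measurable B ->
  P ((id : Om -> samples J) @^-1` A `&` xiI k @^-1` B) =
  (P ((id : Om -> samples J) @^-1` A) * P (xiI k @^-1` B))%E.
Proof.
move=> kJ A B mA mB.
exact: (sample_indep mxiI indep kJ mA mB).
Qed.

Let measurable_x (J : {set index}) : before t \subset J ->
  measurable_vec (x t i : samples J -> 'rV[R]_d).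
Proof. by move=> tJ; apply: measurable_sample_mono tJ ax.1. Qed.

Let k_before : k \notin before t. Proof. by rewrite inE /= ltnn. Qed.

Lemma noise_L2 : L2vec P (noise t i) /\
  Ex P (fun w => sq (noise t i w)) <= sigma ^+ 2.
Proof.
exact: (oracle_noise_L2 (@mid (before t)) (@mxiI k) (indep_k k_before)
  (@mG i) (ltW L_gt0) (f_lip i)
  (oracle_variance so i tT) (measurable_x (subxx _))).
Qed.

Lemma noise_orth (J : {set index}) (V : Om -> 'rV[R]_d) : k \notin J ->
  before t \subset J -> measurable_vec (V : samples J -> 'rV[R]_d) -> L2vec P V ->
  Ex P (fun w => dot (V w) (noise t i w)) = 0.
Proof.
move=> kJ tJ mV lV.
exact: (oracle_noise_orth (@mid J) (@mxiI k) (indep_k kJ)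
  (@mG i) (ltW L_gt0) (f_lip i)
  (oracle_unbiased so i tT) (oracle_variance so i tT) (measurable_x tJ) mV lV).
Qed.

Lemma measurable_noise_samples (J : {set index}) : k \in J ->
  before t \subset J ->
  measurable_vec (noise t i : samples J -> 'rV[R]_d).
Proof.
move=> kJ tJ.
have ms := measurable_sample (xi := xiI) kJ.
exact: (measurable_noise (@mG i) (ltW L_gt0) (f_lip i)
  (measurable_x tJ) (@ms)).
Qed.

Lemma adapted_noise : adapted t.+1 (noise t i).
Proof.
split; last exact: noise_L2.1.
apply: measurable_noise_samples; first by rewrite inE /= ltnSn.
by apply/fintype.subsetP => l; rewrite !inE => /leqW.
Qed.

(** The noise at time [t] is orthogonal to everything determined before. *)
Lemma noise_orth_adapted V : adapted t V ->
  Ex P (fun w => dot (V w) (noise t i w)) = 0.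
Proof. by move=> [mV lV]; apply: (noise_orth k_before). Qed.

End OneSample.

Lemma adapted_oracle t i : (t < T)%N -> adapted t (x t i) ->
  adapted t.+1 (fun w => G (x t i w) (xi i t w)).
Proof.
move=> tT ax.
have -> : (fun w => G (x t i w) (xi i t w)) =
    (fun w => noise t i w + grad (f i) (x t i w)).
  by apply/funext => w; rewrite subrK.
apply: adaptedD; first exact: adapted_noise.
exact: adapted_le (leqnSn t) (adapted_grad _ ax).
Qed.

Lemma noise_orth_noise s t j i : (s < T)%N -> (t < T)%N ->
  adapted s (x s j) -> adapted t (x t i) -> (s, j) != (t, i) ->
  Ex P (fun w => dot (noise s j w) (noise t i w)) = 0.
Proof.
wlog st : s t j i / (s <= t)%N.
  move=> H sT tT ax1 ax2 neq; have [st|/ltnW ts] := leqP s t; first exact: H.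
  under [X in Ex P X]eq_fun do rewrite dotC.
  by apply: H => //; rewrite eq_sym.
move=> sT tT axs axt neq.
pose J := (Ordinal sT, j) |: before t.
have sJ : before s \subset J.
  apply/fintype.subsetP => l; rewrite !inE => ls.
  by rewrite (leq_trans ls st) orbT.
apply: (@noise_orth t i tT axt J).
- rewrite !inE /= ltnn orbF; apply: contra neq => /eqP[<- <-] //.
- by apply/fintype.subsetP => l; rewrite !inE => ->; rewrite orbT.
- by apply: measurable_noise_samples => //; rewrite !inE eqxx.
- exact: (noise_L2 sT axs).1.
Qed.

(** Distinct noises are uncorrelated, so that their variances add up. *)
Lemma noise_sum_var (s : seq (nat * 'I_n)) : uniq s ->
  (forall k, k \in s -> (k.1 < T)%N /\ adapted k.1 (x k.1 k.2)) ->
  L2vec P (fun w => \sum_(k <- s) noise k.1 k.2 w) /\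
  Ex P (fun w => sq (\sum_(k <- s) noise k.1 k.2 w)) <=
    (size s)%:R * sigma ^+ 2.
Proof.
elim: s => [|k s IH] /= => [_ _|/andP[ks us] H].
  under eq_fun do rewrite big_nil; split; first exact: L2vec_cst.
  under [X in Ex P X]eq_fun do rewrite big_nil sq0.
  by rewrite Ex_cst mul0r.
have Hs l : l \in s -> (l.1 < T)%N /\ adapted l.1 (x l.1 l.2).
  by move=> ls; apply: H; rewrite inE ls orbT.
have [lS vS] := IH us Hs; have [kT ak] := H k (mem_head _ _).
have [lk vk] := noise_L2 kT ak.
under eq_fun do rewrite big_cons.
under [X in Ex P X]eq_fun do rewrite big_cons sqD.
have o : Ex P (fun w => dot (noise k.1 k.2 w)
    (\sum_(l <- s) noise l.1 l.2 w)) = 0.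
  under [X in Ex P X]eq_fun do rewrite dot_sumr.
  rewrite Ex_sum => [|l ls]; last first.
    apply: integrable_dot => //; have [lT al] := Hs l ls.
    exact: (noise_L2 lT al).1.
  rewrite big_seq big1// => l ls; have [lT al] := Hs l ls.
  apply: noise_orth_noise => //; rewrite -!surjective_pairing.
  by apply: contraNneq ks => ->.
split; first exact: L2vecD.
have id1 := integrable_dot lk lS.
rewrite ExD ?ExD ?ExZ ?o ?mulr0 ?addr0; last 5 first.
- by [].
- exact: lk.2.
- exact: integrable_rvZ.
- by apply: integrable_rvD; [exact: lk.2|exact: integrable_rvZ].
- exact: lS.2.
by rewrite -natr1 mulrDl mul1r addrC lerD.
Qed.

End Trajectory.

(** * One round of SCAFFOLD *)

Lemma local_range (tau k : nat) : (k.+1 < tau)%N ->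
  (tau <= tau + k <= 2 * tau - 2)%N.
Proof. by move=> kt; apply/andP; split; lia. Qed.

Lemma local_range_end (tau k : nat) : (k.+1 < 2 * tau)%N ->
  (k <= 2 * tau - 2)%N.
Proof. by move=> kt; lia. Qed.

Lemma leq_double (tau : nat) : (tau <= 2 * tau)%N.
Proof. by lia. Qed.

Lemma round_time_lt (tau rounds r k : nat) : (r < rounds)%N ->
  (k < 2 * tau)%N -> (2 * r * tau + k < 2 * rounds * tau)%N.
Proof. by move=> rR kt; nia. Qed.

Lemma local_time_lt (tau k : nat) : (k < tau)%N -> (tau + k < 2 * tau)%N.
Proof. by move=> kt; lia. Qed.

Lemma round_end_time (tau r : nat) :
  (2 * r * tau + tau + tau)%N = (2 * r.+1 * tau)%N.
Proof. by nia. Qed.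

Lemma round_end (tau r : nat) : (0 < tau)%N ->
  (2 * r * tau + tau + tau.-1).+1 = (2 * r.+1 * tau)%N.
Proof. by move=> t0; nia. Qed.


Section Rounds.
Context {R : realType} {n d tau rounds : nat} {dO dX : measure_display}.
Context {Om : measurableType dO}.
Variables (P : probability Om R) (Xi : 'I_n -> measurableType dX).
Variables (L sigma delta rho eta : R) (f : 'I_n -> 'rV[R]_d -> R).
Variables (G : forall i : 'I_n, 'rV[R]_d -> Xi i -> 'rV[R]_d).
Variables (xi : forall i : 'I_n, nat -> Om -> Xi i).
Arguments xi : clear implicits.
Arguments G : clear implicits.
Notation T := (2 * rounds * tau)%N.
Hypothesis so : stochastic_oracle T sigma f P G xi.
Hypotheses (n_gt0 : (0 < n)%N) (tau_gt1 : (1 < tau)%N).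
Hypotheses (L_gt0 : 0 < L) (f_smooth : forall i, smooth L (f i)).
Hypotheses (delta_le : 0 <= delta <= L) (rho_le : 0 <= rho <= L).
Hypothesis f_sim : hessian_similarity delta f.
Hypothesis f_wcvx : forall i, weakly_convex rho (f i).
Hypothesis f_bound : has_lbound (range (global_obj f)).
Hypotheses (eta_gt0 : 0 < eta) (eta_L : L * eta <= 32^-1).
Hypothesis eta_rho : tau%:R * eta * rho <= 32^-1.
Hypothesis eta_delta : tau%:R ^+ 2 * eta ^+ 2 * (L * delta) <= 72^-1.
Variable x : nat -> 'I_n -> Om -> 'rV[R]_d.
Variable x0 : 'rV[R]_d.
Hypothesis sc : forall w, scaffold tau rounds eta x0 (fun t i => x t i w)
  (fun t i => G i (x t i w) (xi i t w)).

Notation adapted := (@adapted R n d T dO dX Om P Xi xi).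
Notation noise := (noise f G xi x).
Notation F := (global_obj f).

Let tau_gt0 : (0 < tau)%N. Proof. exact: ltnW. Qed.
Let tauR : 0 < tau%:R :> R. Proof. by rewrite ltr0n. Qed.
Let nR : 0 < n%:R :> R. Proof. by rewrite ltr0n. Qed.
Let tau_ge1 : 1 <= tau%:R :> R. Proof. by rewrite ler1n. Qed.

(* [g] is the stochastic gradient and [ghat] the control variate. *)
Let g t i w := G i (x t i w) (xi i t w).
Let ghat r i w := tau%:R^-1 *: \sum_(0 <= k < tau) g (2 * r * tau + k)%N i w.

(** The average iterate, gradient and noise at time [t]. *)
Definition mean_iterate t w := mean (fun i => x t i w).
Definition mean_gradient t w := mean (fun i => grad (f i) (x t i w)).
Definition mean_noise t w := mean (fun i => noise t i w).

Let gE t i w : g t i w = grad (f i) (x t i w) + noise t i w.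
Proof. by rewrite /noise addrC subrK. Qed.

Let mean_gE t w :
  mean (fun i => g t i w) = mean_gradient t w + mean_noise t w.
Proof.
by rewrite -meanD; congr mean; apply/funext => i; rewrite gE.
Qed.

Section Paths.
Variables (r : nat) (w : Om).
Hypothesis rR : (r < rounds)%N.

Lemma sampling_phase k i : (k <= tau)%N ->
  x (2 * r * tau + k)%N i w = x (2 * r * tau)%N i w.
Proof.
elim: k => [|k IH] kt; first by rewrite addn0.
by rewrite addnS -[(_ + k).+1]addn1 (scaffold_sample (sc w)) ?IH// ltnW.
Qed.

Lemma mean_ghatE (V : 'I_n -> 'rV[R]_d) :
  mean (fun i => V i - ghat r i w + mean (fun j => ghat r j w)) = mean V.
Proof. by rewrite meanD meanB mean_cst// subrK. Qed.

Lemma local_phase k i : (tau <= k <= 2 * tau - 2)%N ->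
  x (2 * r * tau + k).+1 i w = x (2 * r * tau + k)%N i w
    - eta *: (g (2 * r * tau + k)%N i w - ghat r i w
              + mean (fun j => ghat r j w)).
Proof. by move=> kt; rewrite -[(_ + k).+1]addn1 (scaffold_local (sc w)). Qed.

Lemma mean_local_phase k : (tau <= k <= 2 * tau - 2)%N ->
  mean_iterate (2 * r * tau + k).+1 w = mean_iterate (2 * r * tau + k)%N w
    - eta *: mean (fun i => g (2 * r * tau + k)%N i w).
Proof.
move=> kt; rewrite -{1}(mean_ghatE (fun i => g _ i w)) -meanZ -meanB.
by congr mean; apply/funext => i; exact: local_phase.
Qed.

Lemma mean_local_phase_sum k : (k < tau)%N ->
  mean_iterate (2 * r * tau + tau + k)%N w = mean_iterate (2 * r * tau)%N w
    - eta *: \sum_(0 <= l < k) mean (fun i => g (2 * r * tau + tau + l)%N i w).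
Proof.
elim: k => [_|k IH kt].
  rewrite big_nil scaler0 subr0 addn0; congr mean; apply/funext => i.
  exact: sampling_phase.
rewrite big_nat_recr//= scalerDr opprD addrA -IH ?(ltnW kt)//.
by rewrite addnS -!addnA mean_local_phase// local_range.
Qed.

Lemma sync_phase i : x (2 * r.+1 * tau)%N i w =
  mean_iterate (2 * r * tau + tau + tau.-1)%N w
  - eta *: mean (fun i => g (2 * r * tau + tau + tau.-1)%N i w).
Proof.
rewrite mean_local_phase_sum ?prednK//.
rewrite -[r.+1]addn1 (scaffold_sync (sc w))// -addrA; congr (_ + _).
rewrite -opprD; congr (- _).
rewrite -scalerDr -scalerA; congr (_ *: _).
rewrite exchange_big/= scaler_sumr -{1}(add0n tau) big_addn.
have -> : (2 * tau - tau)%N = tau.-1.+1 by rewrite mul2n -addnn addnK prednK.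
rewrite big_nat_recr//=; congr (_ + _).
  by apply: eq_bigr => l _; rewrite addnA addnAC.
by rewrite addnA addnAC.
Qed.

(** Averaging cancels the control variates; the case [k = tau - 1] is the
    synchronisation, after which the workers agree. *)
Lemma mean_iterate_step k : (k < tau)%N ->
  mean_iterate (2 * r * tau + tau + k).+1 w =
  mean_iterate (2 * r * tau + tau + k)%N w
    - eta *: (mean_gradient (2 * r * tau + tau + k)%N w
              + mean_noise (2 * r * tau + tau + k)%N w).
Proof.
move=> kt; rewrite -mean_gE.
have [k1|k1] := ltnP k.+1 tau.
  by rewrite -addnA mean_local_phase// local_range.
have -> : k = tau.-1 by apply/eqP; rewrite -eqSS prednK// eqn_leq kt.
rewrite round_end//.
rewrite -[RHS](mean_cst n_gt0); congr mean; apply/funext => i.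
exact: sync_phase.
Qed.

End Paths.

Lemma synced r i w : (r <= rounds)%N ->
  x (2 * r * tau)%N i w = mean_iterate (2 * r * tau)%N w.
Proof.
move=> rR; suff [v xv] : exists v, forall j, x (2 * r * tau)%N j w = v.
  rewrite xv /mean_iterate (_ : (fun j => _) = fun=> v) ?mean_cst//.
  by apply/funext => j.
case: r rR => [_|r rR]; last by eexists => j; exact: sync_phase.
by exists x0 => j; rewrite muln0 mul0n (scaffold_init (sc w)).
Qed.


(** All iterates are determined by the earlier samples and are
    square-integrable. *)
Lemma adapted_iterates r : (r <= rounds)%N ->
  (forall i, adapted (2 * r * tau)%N (x (2 * r * tau)%N i)) /\
  forall k i, (r < rounds)%N -> (k < 2 * tau)%N ->
    adapted (2 * r * tau + k)%N (x (2 * r * tau + k)%N i).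
Proof.
have xE t t' i : x t i = x t' i ->
    forall s, adapted s (x t' i) -> adapted s (x t i).
  by move=> ->.
have step s : (s < rounds)%N ->
    (forall i, adapted (2 * s * tau)%N (x (2 * s * tau)%N i)) ->
    forall k i, (k < 2 * tau)%N ->
    adapted (2 * s * tau + k)%N (x (2 * s * tau + k)%N i).
  move=> sR a0.
  have aS k i : (k <= tau)%N ->
      adapted (2 * s * tau + k)%N (x (2 * s * tau + k)%N i).
    move=> kt; apply: (adapted_le (leq_addr k _)).
    apply: (xE _ _ _ _ _ (a0 i)); apply/funext => w.
    exact: sampling_phase.
  have ag k i : (k < tau)%N -> adapted (2 * s * tau + tau)%N
      (g (2 * s * tau + k)%N i).
    move=> kt; apply: (@adapted_le _ _ _ _ _ _ _ _ _ _ (2 * s * tau + k).+1).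
      by rewrite -addnS leq_add2l.
    apply: (adapted_oracle so L_gt0 f_smooth) => //; last exact: aS (ltnW kt).
    exact: round_time_lt sR (leq_trans kt (leq_double tau)).
  have aghat i : adapted (2 * s * tau + tau)%N (ghat s i).
    apply: adaptedZ; apply: adapted_sum => k; rewrite mem_index_iota.
    by move=> /andP[_ kt]; exact: ag.
  have aghatm : adapted (2 * s * tau + tau)%N
      (fun w => mean (fun j => ghat s j w)).
    exact: adapted_mean.
  elim=> [|k IH] i kt; first exact: aS.
  have [kt'|kt'] := ltnP k tau; first exact: aS.
  have e w : x (2 * s * tau + k.+1)%N i w = x (2 * s * tau + k)%N i w
      - eta *: (g (2 * s * tau + k)%N i w - ghat s i w
                + mean (fun j => ghat s j w)).
    by rewrite addnS local_phase// kt' local_range_end.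
  have -> : x (2 * s * tau + k.+1)%N i = _ := funext e.
  have lt : (2 * s * tau + tau <= 2 * s * tau + k.+1)%N.
    by rewrite leq_add2l leqW.
  apply: adaptedB.
    by apply: adapted_le (IH i (ltnW kt)); rewrite leq_add2l.
  apply: adaptedZ; apply: adaptedD; last exact: adapted_le aghatm.
  apply: adaptedB; last exact: adapted_le (aghat i).
  rewrite addnS; apply: (adapted_oracle so L_gt0 f_smooth) => //;
    last exact: IH (ltnW kt).
  exact: round_time_lt sR (ltnW kt).
have start s : (s <= rounds)%N ->
    forall i, adapted (2 * s * tau)%N (x (2 * s * tau)%N i).
  elim: s => [_ i|s IH sR i].
    have -> : x (2 * 0 * tau)%N i = fun=> x0.
      by apply/funext => w; rewrite muln0 mul0n (scaffold_init (sc w)).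
    exact: adapted_cst.
  have aI := step s sR (IH (ltnW sR)).
  have e w : x (2 * s.+1 * tau)%N i w =
      mean_iterate (2 * s * tau + tau + tau.-1)%N w
      - eta *: mean (fun i => g (2 * s * tau + tau + tau.-1)%N i w).
    exact: sync_phase.
  have -> : x (2 * s.+1 * tau)%N i = _ := funext e.
  have lt : (tau + tau.-1 < 2 * tau)%N by rewrite mul2n -addnn ltn_add2l prednK.
  rewrite -(round_end s tau_gt0).
  have a1 j : adapted (2 * s * tau + tau + tau.-1)%N
      (x (2 * s * tau + tau + tau.-1)%N j).
    by rewrite -addnA; exact: aI.
  apply: adaptedB.
    by apply: adapted_le (leqnSn _) _; apply: adapted_mean => j; exact: a1.
  apply: adaptedZ; apply: adapted_mean => j.
  apply: (adapted_oracle so L_gt0 f_smooth) => //.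
  by rewrite -addnA; exact: round_time_lt sR lt.
move=> rR; split; first exact: start.
by move=> k i rR' kt; exact: step rR' (start r (ltnW rR')) k i kt.
Qed.

Section Time.
Variable t : nat.
Hypotheses (tT : (t < T)%N) (ax : forall i, adapted t (x t i)).

Lemma adapted_mean_iterate : adapted t (mean_iterate t).
Proof. by apply: adapted_mean => i; exact: ax. Qed.

Lemma adapted_mean_gradient : adapted t (mean_gradient t).
Proof.
apply: adapted_mean => i.
exact: (adapted_grad (xi := xi) L_gt0 f_smooth i (ax i)).
Qed.

(** Averaging over the workers divides the noise variance by [n]. *)
Lemma mean_noise_L2 : L2vec P (mean_noise t) /\
  Ex P (fun w => sq (mean_noise t w)) <= sigma ^+ 2 / n%:R.
Proof.
pose s := [seq (t, i) | i <- enum 'I_n].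
have us : uniq s by rewrite map_inj_uniq ?enum_uniq// => i j [].
have hs k : k \in s -> (k.1 < T)%N /\ adapted k.1 (x k.1 k.2).
  by move=> /mapP[i _ ->].
have [lS vS] := noise_sum_var so L_gt0 f_smooth us hs.
have E : (fun w => \sum_(k <- s) noise k.1 k.2 w) =
    (fun w => \sum_(i < n) noise t i w).
  by apply/funext => w; rewrite big_map big_enum.
have Esq : (fun w => sq (\sum_(k <- s) noise k.1 k.2 w)) =
    (fun w => sq (\sum_(i < n) noise t i w)).
  by apply/funext => w; rewrite big_map big_enum.
rewrite E in lS; rewrite Esq size_map size_enum_ord in vS.
split; first exact: L2vecZ.
under [X in Ex P X]eq_fun do rewrite sqZ.
rewrite ExZ; last exact: lS.2.
apply: le_trans (ler_wpM2l (sqr_ge0 _) vS) _.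
rewrite le_eqVlt; apply/orP; left; apply/eqP.
by field; rewrite gt_eqF.
Qed.

Lemma mean_noise_orth V : adapted t V ->
  Ex P (fun w => dot (V w) (mean_noise t w)) = 0.
Proof.
move=> aV; have iz i := (noise_L2 so L_gt0 f_smooth tT (ax i)).1.
under [X in Ex P X]eq_fun do rewrite dotZr dot_sumr.
have ii i : integrable_rv P (fun w => dot (V w) (noise t i w)).
  by apply: integrable_dot; [exact: aV.2|exact: iz].
rewrite ExZ ?Ex_sum; last 2 first.
- by move=> i _; exact: ii.
- by apply: integrable_rv_sum => i _; exact: ii.
rewrite big1 ?mulr0// => i _.
exact: (noise_orth_adapted so L_gt0 f_smooth tT (ax i) aV).
Qed.

End Time.

Lemma F_smooth : smooth L F.
Proof. exact: global_smooth. Qed.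

Let F_lip (u v : 'rV[R]_d) : sq (grad F u - grad F v) <= L ^+ 2 * sq (u - v).
Proof. by apply: smooth_sq; [exact: ltW|exact: F_smooth]. Qed.

Lemma integrable_objective X : L2vec P X -> integrable_rv P (fun w => F (X w)).
Proof.
move=> lX; have [B lB] := f_bound.
have FB v : B <= F v by apply: lB; exists v.
pose U w := F 0 + dot (grad F 0) (X w) + L / 2 * sq (X w).
have FU w : F (X w) <= U w.
  have := smooth_descent 0 (X w) L_gt0 F_smooth; by rewrite subr0.
have mF : measurable_fun setT (fun v : borel_rV R d => F v).
  apply: (measurability _ (RGenOpens.measurableE R)) => _ [_ [a [b ->]] <-].
  rewrite setTI; apply: sub_sigma_algebra => /=.
  apply: open_comp; last exact: interval_open.
  by move=> v _; apply: differentiable_continuous; exact: (F_smooth.1 v).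
apply: (@integrable_rv_le _ _ _ _ _ (fun w => U w + 2 * `|B|)).
- exact: (measurableT_comp mF lX.1).
- move=> w; have := FB (X w); have := FU w.
  have := ler_norm (- B); rewrite normrN => h1 h2 h3.
  by have h4 := normr_ge0 B; rewrite ler_norml; apply/andP; split; lra.
- apply: integrable_rvD; last exact: integrable_rv_cst.
  apply: integrable_rvD; last by apply: integrable_rvZ; exact: lX.2.
  apply: integrable_rvD; first exact: integrable_rv_cst.
  by apply: integrable_dot => //; exact: L2vec_cst.
Qed.

Section Expectations.
Variable r : nat.
Hypothesis rR : (r < rounds)%N.

Notation tm k := (2 * r * tau + tau + k)%N.

Let tmT k : (k < tau)%N -> (tm k < T)%N.
Proof. by move=> kt; rewrite -addnA round_time_lt// local_time_lt. Qed.

Let ax k i : (k < tau)%N -> adapted (tm k) (x (tm k) i).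
Proof.
move=> kt; have [_ a] := adapted_iterates (ltnW rR).
by rewrite -addnA; apply: a => //; exact: local_time_lt.
Qed.

Let ybar k := mean_iterate (tm k).

Let L2_ybar k : (k <= tau)%N -> L2vec P (ybar k).
Proof.
rewrite leq_eqVlt => /predU1P[->|kt]; last first.
  by apply: L2vec_mean => i; exact: (ax i kt).2.
rewrite /ybar; apply: L2vec_mean => i; have [a _] := adapted_iterates rR.
by rewrite round_end_time; exact: (a i).2.
Qed.

Let ybar_step k w : (k < tau)%N -> ybar k.+1 w =
  ybar k w - eta *: (mean_gradient (tm k) w + mean_noise (tm k) w).
Proof. by move=> kt; rewrite /ybar addnS mean_iterate_step. Qed.

(** The noise of the control variate of worker [i]. *)
Let zhat i w := tau%:R^-1 *: \sum_(0 <= k < tau) noise (2 * r * tau + k)%N i w.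

Let ybar0 w : ybar 0 w = mean_iterate (2 * r * tau)%N w.
Proof.
by rewrite /ybar addn0; congr mean; apply/funext => i; exact: sampling_phase.
Qed.

Let ghatE i w : ghat r i w = grad (f i) (ybar 0 w) + zhat i w.
Proof.
have -> : ghat r i w = tau%:R^-1 *: \sum_(0 <= k < tau)
    (grad (f i) (ybar 0 w) + noise (2 * r * tau + k)%N i w).
  congr (_ *: _); apply: eq_big_nat => k /andP[_ kt].
  by rewrite gE sampling_phase ?(ltnW kt)// synced ?(ltnW rR)// ybar0.
rewrite big_split/= scalerDr; congr (_ + _).
rewrite sumr_const_nat subn0 -[grad _ _ *+ tau]scaler_nat scalerA.
by rewrite mulVf ?scale1r// gt_eqF.
Qed.

Let ax0 k i : (k < tau)%N -> (2 * r * tau + k < T)%N /\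
  adapted (2 * r * tau + k)%N (x (2 * r * tau + k)%N i).
Proof.
move=> kt; have [_ a] := adapted_iterates (ltnW rR).
have kt2 := leq_trans kt (leq_double tau).
by split; [exact: round_time_lt|exact: a].
Qed.

Let zhat_adapted i : adapted (2 * r * tau + tau)%N (zhat i).
Proof.
apply: adaptedZ; apply: adapted_sum => k; rewrite mem_index_iota => /andP[_ kt].
have [kT ak] := ax0 i kt.
apply: adapted_le (adapted_noise so L_gt0 f_smooth kT ak).
by rewrite -addnS leq_add2l.
Qed.

Let zhat_var i : Ex P (fun w => sq (zhat i w)) <= sigma ^+ 2 / tau%:R.
Proof.
pose s := [seq ((2 * r * tau + k)%N, i) | k <- index_iota 0 tau].
have us : uniq s.
  by rewrite map_inj_uniq ?iota_uniq// => a b [/addnI].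
have hs k : k \in s -> (k.1 < T)%N /\ adapted k.1 (x k.1 k.2).
  by move=> /mapP[j]; rewrite mem_index_iota => /andP[_ jt] -> /=; exact: ax0.
have [lS vS] := noise_sum_var so L_gt0 f_smooth us hs.
have E w : \sum_(k <- s) noise k.1 k.2 w =
    \sum_(0 <= k < tau) noise (2 * r * tau + k)%N i w by rewrite big_map.
rewrite size_map size_iota subn0 in vS.
have -> : (fun w => sq (zhat i w)) =
    (fun w => tau%:R^-1 ^+ 2 * sq (\sum_(k <- s) noise k.1 k.2 w)).
  by apply/funext => w; rewrite E -sqZ.
rewrite ExZ; last exact: lS.2.
apply: le_trans (ler_wpM2l (sqr_ge0 _) vS) _.
rewrite le_eqVlt; apply/orP; left; apply/eqP.
by field; rewrite gt_eqF.
Qed.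

Let errors k w := consensus_error (fun i => x (tm k) i w).

Let integrable_errors k : (k < tau)%N -> integrable_rv P (errors k).
Proof.
move=> kt; apply: integrable_rvZ; apply: integrable_rv_sum => i _.
have : L2vec P (fun w => x (tm k) i w - ybar k w).
  by apply: L2vecB; [exact: (ax i kt).2|exact: L2_ybar (ltnW kt)].
by case.
Qed.

Let adapted_ybar k : (k < tau)%N -> adapted (tm k) (ybar k).
Proof. by move=> kt; apply: adapted_mean_iterate => i; exact: ax. Qed.

Let adapted_ybar0 k : (k < tau)%N -> adapted (tm k) (ybar 0).
Proof.
by move=> kt; apply: adapted_le (adapted_ybar tau_gt0); rewrite leq_add2l.
Qed.

Let adapted_mg k : (k < tau)%N -> adapted (tm k) (mean_gradient (tm k)).
Proof. by move=> kt; apply: adapted_mean_gradient => i; exact: ax. Qed.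

Let mz k : (k < tau)%N -> L2vec P (mean_noise (tm k)) /\
  Ex P (fun w => sq (mean_noise (tm k) w)) <= sigma ^+ 2 / n%:R.
Proof. by move=> kt; apply: mean_noise_L2 => [|i]; [exact: tmT|exact: ax]. Qed.

Let orth k V : (k < tau)%N -> adapted (tm k) V ->
  Ex P (fun w => dot (V w) (mean_noise (tm k) w)) = 0.
Proof.
by move=> kt; apply: mean_noise_orth => [|i]; [exact: tmT|exact: ax].
Qed.

(** Expected descent of the objective. *)
Let descent k : (k < tau)%N ->
  Ex P (fun w => F (ybar k.+1 w)) <=
  Ex P (fun w => F (ybar k w)) - eta / 2 * Ex P (fun w => sq (grad F (ybar k w)))
  - eta / 2 * (1 - L * eta) * Ex P (fun w => sq (mean_gradient (tm k) w))
  + eta / 2 * L ^+ 2 * Ex P (errors k)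
  + L * eta ^+ 2 / 2 * (sigma ^+ 2 / n%:R).
Proof.
move=> kt; have [lz vz] := mz kt.
have lg : L2vec P (fun w => grad F (ybar k w)).
  by apply: L2vec_lipschitz F_lip _; [exact: ltW|exact: L2_ybar (ltnW kt)].
have ag : adapted (tm k) (fun w => grad F (ybar k w)).
  by apply: adapted_lipschitz F_lip _; [exact: ltW|exact: adapted_ybar].
have am := adapted_mg kt.
have iF := integrable_objective (L2_ybar (ltnW kt)).
have iF' := integrable_objective (L2_ybar kt).
have ig := lg.2; have im := am.2.2; have iz := lz.2.
have ie := integrable_errors kt.
have imz := integrable_dot am.2 lz; have igz := integrable_dot lg lz.
pose h1 w := F (ybar k w) - eta / 2 * sq (grad F (ybar k w)).
pose h2 w := h1 w - eta / 2 * (1 - L * eta) * sq (mean_gradient (tm k) w).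
pose h3 w := h2 w + eta / 2 * L ^+ 2 * errors k w.
pose h4 w := L * eta ^+ 2 * dot (mean_gradient (tm k) w) (mean_noise (tm k) w)
  - eta * dot (grad F (ybar k w)) (mean_noise (tm k) w).
pose h5 w := h3 w + h4 w + L * eta ^+ 2 / 2 * sq (mean_noise (tm k) w).
have i1 : integrable_rv P h1.
  by apply: integrable_rvB => //; exact: integrable_rvZ.
have i2 : integrable_rv P h2.
  by apply: integrable_rvB => //; exact: integrable_rvZ.
have i3 : integrable_rv P h3.
  by apply: integrable_rvD => //; exact: integrable_rvZ.
have i4 : integrable_rv P h4.
  by apply: integrable_rvB; exact: integrable_rvZ.
have i34 := integrable_rvD i3 i4.
have i5 : integrable_rv P h5.
  by apply: integrable_rvD => //; exact: integrable_rvZ.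
apply: (@le_trans _ _ (Ex P h5)).
  apply: Ex_le => // w; rewrite ybar_step//.
  exact: (descent_step n_gt0 L_gt0 f_smooth eta_gt0).
have e4 : Ex P h4 = 0.
  by rewrite (ExB (integrable_rvZ _ imz) (integrable_rvZ _ igz)) !ExZ// !orth//
    !mulr0 subr0.
have e1 : Ex P h1 = Ex P (fun w => F (ybar k w))
    - eta / 2 * Ex P (fun w => sq (grad F (ybar k w))).
  by rewrite (ExB iF (integrable_rvZ _ ig)) ExZ.
have e2 : Ex P h2 = Ex P h1
    - eta / 2 * (1 - L * eta) * Ex P (fun w => sq (mean_gradient (tm k) w)).
  by rewrite (ExB i1 (integrable_rvZ _ im)) ExZ.
have e3 : Ex P h3 = Ex P h2 + eta / 2 * L ^+ 2 * Ex P (errors k).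
  by rewrite (ExD i2 (integrable_rvZ _ ie)) ExZ.
have e5 : Ex P h5 = Ex P h3
    + L * eta ^+ 2 / 2 * Ex P (fun w => sq (mean_noise (tm k) w)).
  by rewrite (ExD i34 (integrable_rvZ _ iz)) (ExD i3 i4) e4 addr0 ExZ.
rewrite e5 e3 e2 e1 lerD2l; apply: ler_wpM2l => //.
by rewrite mulr_ge0// mulr_ge0 ?sqr_ge0// ltW.
Qed.

(** Expected squared distance of the average iterate to the starting point. *)
Let distance k : (k < tau)%N ->
  Ex P (fun w => sq (ybar k.+1 w - ybar 0 w)) <=
  (1 + (2 * tau%:R)^-1) * Ex P (fun w => sq (ybar k w - ybar 0 w))
  + 3 * tau%:R * eta ^+ 2 * Ex P (fun w => sq (mean_gradient (tm k) w))
  + eta ^+ 2 * sigma ^+ 2.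
Proof.
move=> kt; have [lz vz] := mz kt; have am := adapted_mg kt.
have ad : adapted (tm k) (fun w => ybar k w - ybar 0 w).
  by apply: adaptedB; [exact: adapted_ybar|exact: adapted_ybar0].
have av := adaptedB ad (adaptedZ eta am).
have -> : (fun w => sq (ybar k.+1 w - ybar 0 w)) =
    (fun w => sq (ybar k w - ybar 0 w - eta *: mean_gradient (tm k) w
                  - eta *: mean_noise (tm k) w)).
  apply/funext => w; rewrite ybar_step//; congr sq.
  rewrite scalerDr; move: (ybar k w) (ybar 0 w) (eta *: _) (eta *: _) => a b c e.
  by apply/rowP => j; rewrite !mxE; ring.
rewrite (Ex_sqB _ av.2 lz); last exact: orth.
apply: lerD; last first.
  apply: ler_wpM2l; first exact: sqr_ge0.
  apply: le_trans vz _; rewrite ler_pdivrMr// ler_peMr ?sqr_ge0//.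
  by rewrite ler1n.
have c0 : 0 < (2 * tau%:R)^-1 :> R by rewrite invr_gt0 mulr_gt0.
pose h w := (1 + (2 * tau%:R)^-1) * sq (ybar k w - ybar 0 w)
  + 3 * tau%:R * eta ^+ 2 * sq (mean_gradient (tm k) w).
have i1 := integrable_rvZ (1 + (2 * tau%:R)^-1) ad.2.2.
have i2 := integrable_rvZ (3 * tau%:R * eta ^+ 2) am.2.2.
apply: (@le_trans _ _ (Ex P h)); last first.
  by rewrite (ExD i1 i2) (ExZ _ ad.2.2) (ExZ _ am.2.2).
apply: Ex_le => [||w]; [exact: av.2.2|exact: integrable_rvD|].
apply: le_trans (sqD_young _ _ c0) _; rewrite sqN sqZ invrK lerD2l mulrA.
apply: ler_wpM2r; first exact: sq_ge0.
by apply: ler_wpM2r; [exact: sqr_ge0|have := tau_ge1; lra].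
Qed.

(** Expected consensus error. *)
Let consensus k : (k.+1 < tau)%N ->
  Ex P (errors k.+1) <= (1 + (2 * tau%:R)^-1) * Ex P (errors k)
  + 18 * tau%:R * eta ^+ 2 * delta ^+ 2 * Ex P (fun w => sq (ybar k w - ybar 0 w))
  + 19 * eta ^+ 2 * sigma ^+ 2.
Proof.
move=> kt1; have kt := ltnW kt1.
pose z i := noise (tm k) i.
have zP i := noise_L2 so L_gt0 f_smooth (tmT kt) (ax i kt).
pose dev i w := deviation f eta (fun i => x (tm k) i w) (ybar 0 w) (zhat^~ w) i.
have ay := adapted_ybar kt; have ay0 := adapted_ybar0 kt.
have agF X : adapted (tm k) X -> adapted (tm k) (fun w => grad F (X w)).
  by apply: adapted_lipschitz F_lip; exact: ltW.
have agf i X : adapted (tm k) X -> adapted (tm k) (fun w => grad (f i) (X w)).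
  exact: (adapted_grad (xi := xi) L_gt0 f_smooth).
have adev i : adapted (tm k) (dev i).
  apply: adaptedB.
    apply: adaptedB; first by apply: adaptedB => //; exact: ax.
    by apply: adaptedZ; apply: adaptedB; apply: agf => //; exact: ax.
  apply: adaptedZ; apply: adaptedB.
    apply: adaptedD; last exact: agF.
    apply: adaptedB; last exact: agf.
    by apply: adaptedB; [exact: agf|exact: agF].
  by apply: adapted_le (zhat_adapted i); rewrite leq_addr.
have izd i := (L2vecB (adev i).2 (L2vecZ eta (zP i).1)).2.
have n0 : 0 <= n%:R^-1 :> R by rewrite invr_ge0.
(* the consensus error is at most that of the deviations with fresh noise *)
apply: (@le_trans _ _ (Ex P (fun w => n%:R^-1 *
    \sum_i sq (dev i w - eta *: z i w)))).
  apply: Ex_le => [||w]; first exact: integrable_errors.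
    by apply: integrable_rvZ; apply: integrable_rv_sum => i _; exact: izd.
  rewrite /errors.
  apply: (consensus_step n_gt0 (c := mean (fun j => ghat r j w))) => i.
  rewrite addnS -ghatE -gE -!addnA local_phase ?local_range//.
have -> : Ex P (fun w => n%:R^-1 * \sum_i sq (dev i w - eta *: z i w)) =
    n%:R^-1 * (\sum_i (Ex P (fun w => sq (dev i w))
                       + eta ^+ 2 * Ex P (fun w => sq (z i w)))).
  rewrite ExZ ?Ex_sum; last 2 first.
  - by move=> i _; exact: izd.
  - by apply: integrable_rv_sum => i _; exact: izd.
  congr (_ * _); apply: eq_bigr => i _; apply: Ex_sqB.
  - exact: (adev i).2.
  - exact: (zP i).1.
  - exact: (noise_orth_adapted so L_gt0 f_smooth (tmT kt) (ax i kt) (adev i)).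
rewrite big_split/= mulrDr.
have fresh : n%:R^-1 * \sum_i (eta ^+ 2 * Ex P (fun w => sq (z i w)))
    <= eta ^+ 2 * sigma ^+ 2.
  rewrite ler_pdivrMl//.
  apply: (@le_trans _ _ (\sum_(i < n) eta ^+ 2 * sigma ^+ 2)).
    apply: ler_sum => i _; apply: ler_wpM2l; first exact: sqr_ge0.
    exact: (zP i).2.
  by rewrite sumr_const card_ord -[_ *+ n]mulr_natl.
pose a : R := (8 * tau%:R)^-1.
have a0 : 0 < a by rewrite invr_gt0 mulr_gt0.
have aV : a^-1 = 8 * tau%:R by rewrite invrK.
have [r0 rL] := andP rho_le.
pose A := (1 + a) * (1 + 4 * eta * rho).
pose B := 2 * (1 + a^-1) * eta ^+ 2.
have e0 := integrable_errors kt.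
have p0 : integrable_rv P (fun w => sq (ybar k w - ybar 0 w)).
  exact: (L2vecB ay.2 ay0.2).2.
have iz0 : integrable_rv P (fun w => \sum_i sq (zhat i w)).
  by apply: integrable_rv_sum => i _; exact: (zhat_adapted i).2.2.
have iz := integrable_rvZ n%:R^-1 iz0.
have old : n%:R^-1 * (\sum_i Ex P (fun w => sq (dev i w))) <=
    A * Ex P (errors k)
    + B * (delta ^+ 2 * Ex P (fun w => sq (ybar k w - ybar 0 w))
      + sigma ^+ 2 / tau%:R).
  rewrite -Ex_sum => [|i _]; last exact: (adev i).2.2.
  have isum : integrable_rv P (fun w => \sum_i sq (dev i w)).
    by apply: integrable_rv_sum => i _; exact: (adev i).2.2.
  rewrite -(ExZ _ isum).
  pose h w := A * errors k w + B * (delta ^+ 2 * sq (ybar k w - ybar 0 w)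
      + n%:R^-1 * \sum_i sq (zhat i w)).
  have id := integrable_rvZ (delta ^+ 2) p0.
  have ih : integrable_rv P h.
    apply: integrable_rvD; first exact: integrable_rvZ.
    by apply: integrable_rvZ; apply: integrable_rvD.
  apply: (@le_trans _ _ (Ex P h)).
    apply: Ex_le => // [|w]; first exact: integrable_rvZ.
    apply: (deviation_le L_gt0 f_smooth eta_gt0) => //.
    by rewrite mulrC; apply: le_trans eta_L _; lra.
  have iD := integrable_rvD id iz.
  rewrite (ExD (integrable_rvZ A e0) (integrable_rvZ B iD)) (ExZ A e0) (ExZ B iD).
  rewrite (ExD id iz) (ExZ _ p0) (ExZ _ iz0).
  rewrite lerD2l; apply: ler_wpM2l.
    by rewrite mulr_ge0 ?sqr_ge0// mulr_ge0// addr_ge0// invr_ge0 ltW.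
  rewrite lerD2l Ex_sum => [|i _]; last exact: (zhat_adapted i).2.2.
  rewrite ler_pdivrMl//.
  apply: (@le_trans _ _ (\sum_(i < n) sigma ^+ 2 / tau%:R)).
    by apply: ler_sum => i _; exact: zhat_var.
  by rewrite sumr_const card_ord -[_ *+ n]mulr_natl.
apply: le_trans (lerD old fresh) _.
have Ele : 0 <= Ex P (errors k).
  apply: Ex_ge0 => w; rewrite mulr_ge0//; apply: sumr_ge0 => i _; exact: sq_ge0.
have Ple : 0 <= Ex P (fun w => sq (ybar k w - ybar 0 w)).
  by apply: Ex_ge0 => w; exact: sq_ge0.
have hA : A <= 1 + (2 * tau%:R)^-1.
  have -> : (2 * tau%:R)^-1 = 4 * a by rewrite /a; field; rewrite gt_eqF.
  have a1 : a <= 1.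
    by rewrite invf_le1 ?mulr_gt0//; have := tau_ge1; lra.
  have er : 4 * eta * rho <= a.
    rewrite /a -[_^-1]mul1r ler_pdivlMr ?mulr_gt0//.
    by have := eta_rho; lra.
  rewrite /A; apply: (@le_trans _ _ ((1 + a) * (1 + a))).
    by apply: ler_wpM2l; [rewrite addr_ge0// ltW|rewrite lerD2l].
  have : a * a <= a by rewrite ler_piMr// ltW.
  by lra.
have hB : B <= 18 * tau%:R * eta ^+ 2.
  rewrite /B aV; apply: ler_wpM2r; first exact: sqr_ge0.
  by have := tau_ge1; lra.
have hBs : B * (sigma ^+ 2 / tau%:R) <= 18 * (eta ^+ 2 * sigma ^+ 2).
  have s0 : 0 <= sigma ^+ 2 / tau%:R by rewrite divr_ge0 ?sqr_ge0.
  apply: le_trans (ler_wpM2r s0 hB) _.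
  by rewrite le_eqVlt; apply/orP; left; apply/eqP; field; rewrite gt_eqF.
have h1 := ler_wpM2r Ele hA.
have h2 := ler_wpM2r (mulr_ge0 (sqr_ge0 delta) Ple) hB.
by rewrite mulrDr; lra.
Qed.

Lemma round_expectation :
  \sum_(0 <= k < tau) Ex P (fun w => sq (grad F (mean_iterate (tm k) w))) <=
  2 / eta * (Ex P (fun w => F (mean_iterate (2 * r * tau)%N w))
             - Ex P (fun w => F (mean_iterate (2 * r.+1 * tau)%N w)))
  + 39 * L ^+ 2 * tau%:R ^+ 2 * eta ^+ 2 * sigma ^+ 2
  + tau%:R * L * eta * (sigma ^+ 2 / n%:R).
Proof.
have -> : (fun w => F (mean_iterate (2 * r * tau)%N w)) = (fun w => F (ybar 0 w)).
  by apply/funext => w; rewrite ybar0.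
have -> : (fun w => F (mean_iterate (2 * r.+1 * tau)%N w)) =
    (fun w => F (ybar tau w)).
  by apply/funext => w; rewrite /ybar round_end_time.
apply: (@round_bound _ tau n L delta eta (sigma ^+ 2)
  (fun k => Ex P (fun w => F (ybar k w))) _
  (fun k => Ex P (fun w => sq (mean_gradient (tm k) w)))
  (fun k => Ex P (fun w => sq (ybar k w - ybar 0 w)))
  (fun k => Ex P (errors k))) => //.
- exact: sqr_ge0.
- by apply: le_trans eta_L _; lra.
- by under [X in Ex P X]eq_fun do rewrite subrr sq0; rewrite Ex_cst.
- have -> : errors 0 = fun=> 0.
    apply/funext => w; rewrite /errors /consensus_error big1 ?mulr0// => i _.
    rewrite -/(mean_iterate (tm 0) w) -/(ybar 0 w) ybar0 addn0 sampling_phase//.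
    by rewrite synced ?(ltnW rR)// subrr sq0.
  by rewrite Ex_cst.
- by move=> k _; apply: Ex_ge0 => w; exact: sq_ge0.
- by move=> k _; apply: Ex_ge0 => w; exact: sq_ge0.
- move=> k _; apply: Ex_ge0 => w; rewrite mulr_ge0 ?invr_ge0//.
  by apply: sumr_ge0 => i _; exact: sq_ge0.
- by move=> k kt; exact: distance (ltnW kt).
Qed.

End Expectations.

(** Telescoping over the rounds. *)
Lemma rounds_expectation :
  \sum_(0 <= r < rounds) \sum_(0 <= k < tau)
    Ex P (fun w => sq (grad F (mean_iterate (2 * r * tau + tau + k)%N w))) <=
  2 / eta * (F x0 - inf (range F))
  + rounds%:R * (39 * L ^+ 2 * tau%:R ^+ 2 * eta ^+ 2 * sigma ^+ 2
                 + tau%:R * L * eta * (sigma ^+ 2 / n%:R)).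
Proof.
pose Phi r := Ex P (fun w => F (mean_iterate (2 * r * tau)%N w)).
have Phi0 : Phi 0%N = F x0.
  rewrite /Phi; have -> : (fun w => F (mean_iterate (2 * 0 * tau)%N w)) =
      fun=> F x0; last by rewrite Ex_cst.
  apply/funext => w; rewrite -[in RHS](mean_cst n_gt0 x0); congr F; congr mean.
  by apply/funext => i; rewrite muln0 mul0n (scaffold_init (sc w)).
have PhiT : inf (range F) <= Phi rounds.
  rewrite -(Ex_cst P (inf _)); apply: Ex_le; first exact: integrable_rv_cst.
    apply: integrable_objective; apply: L2vec_mean => i.
    exact: ((adapted_iterates (leqnn rounds)).1 i).2.
  by move=> w; apply: ge_inf => //; eexists.
set c := _ + _ * _ * _ * _.
apply: (@le_trans _ _ (\sum_(0 <= r < rounds)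
    (2 / eta * (Phi r - Phi r.+1) + c))).
  apply: ler_sum_nat => r /andP[_ rR].
  by have := round_expectation rR; rewrite /c addrA.
rewrite big_split/= -mulr_sumr sumr_const_nat subn0 -[_ *+ rounds]mulr_natl.
rewrite lerD2r ler_pM2l ?divr_gt0//.
have -> : \sum_(0 <= i < rounds) (Phi i - Phi i.+1) = Phi 0%N - Phi rounds.
  rewrite -[RHS]opprB -(telescope_sumr Phi (leq0n rounds)) -sumrN.
  by apply: eq_bigr => i _; rewrite opprB.
by rewrite Phi0 lerD2l lerN2.
Qed.

(** The summands are integrable, so that the bound also holds for the
    extended-real expectations. *)
Lemma integrable_grad r k : (r < rounds)%N -> (k < tau)%N ->
  integrable_rv P (fun w =>
    sq (grad F (mean_iterate (2 * r * tau + tau + k)%N w))).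
Proof.
move=> rR kt; suff : L2vec P (fun w =>
    grad F (mean_iterate (2 * r * tau + tau + k)%N w)) by case.
apply: L2vec_lipschitz F_lip _; first exact: ltW.
apply: L2vec_mean => i; rewrite -addnA.
apply: (((adapted_iterates (ltnW rR)).2 (tau + k)%N i rR) _).2.
exact: local_time_lt.
Qed.

End Rounds.

(** * Choice of the stepsize *)

Lemma powR_frac3 (R : realType) (a : R) (k : nat) : 0 <= a ->
  (a `^ (k%:R / 3)) ^+ 3 = a ^+ k.
Proof.
move=> a0; rewrite -!powR_mulrn ?powR_ge0// -powRrM.
by congr (_ `^ _); field.
Qed.

(** The stepsize balances the three terms of the bound: with [B] their weighted
    sum, [eta = Delta / (rounds * tau * B)] satisfies every smallness condition
    because [B] dominates each of its terms. *)
Lemma stepsize (R : realType) (n tau rounds : nat)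
    (L Delta sigma delta rho : R) :
  (0 < n)%N -> (0 < tau)%N -> (0 < rounds)%N -> 0 < L -> 0 < Delta ->
  0 <= sigma -> 0 <= delta -> 0 <= rho ->
  exists eta : R, [/\ 0 < eta, L * eta <= 32^-1, tau%:R * eta * rho <= 32^-1,
    tau%:R ^+ 2 * eta ^+ 2 * (L * delta) <= 72^-1 &
    2 / (2 * rounds * tau)%N%:R *
      (2 / eta * Delta
       + rounds%:R * (39 * L ^+ 2 * tau%:R ^+ 2 * eta ^+ 2 * sigma ^+ 2
                      + tau%:R * L * eta * (sigma ^+ 2 / n%:R))) <=
    64 * ((L / tau%:R + Num.sqrt (L * delta) + rho) * (Delta / rounds%:R)
      + Num.sqrt (L * Delta * sigma ^+ 2 / (n%:R * tau%:R * rounds%:R))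
      + (L * Delta * sigma) `^ (2 / 3)
        / (tau%:R `^ (1 / 3) * rounds%:R `^ (2 / 3)))].
Proof.
move=> n0 t0 R0 L0 D0 s0 d0 r0.
have nR : 0 < n%:R :> R by rewrite ltr0n.
have tR : 0 < tau%:R :> R by rewrite ltr0n.
have RR : 0 < rounds%:R :> R by rewrite ltr0n.
set q := Num.sqrt (L * delta); have q0 : 0 <= q by exact: sqrtr_ge0.
have q2 : q ^+ 2 = L * delta by rewrite sqr_sqrtr// mulr_ge0// ltW.
set S := Num.sqrt (L * Delta * _ / _).
have S0 : 0 <= S by exact: sqrtr_ge0.
have S2 : S ^+ 2 = L * Delta * sigma ^+ 2 / (n%:R * tau%:R * rounds%:R).
  rewrite sqr_sqrtr// divr_ge0 ?mulr_ge0 ?sqr_ge0//; exact: ltW.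
set W := _ `^ _ / _.
have W0 : 0 <= W by rewrite divr_ge0 ?mulr_ge0 ?powR_ge0.
have W3 : W ^+ 3 = L ^+ 2 * Delta ^+ 2 * sigma ^+ 2 / (tau%:R * rounds%:R ^+ 2).
  have LD0 : 0 <= L * Delta * sigma by rewrite !mulr_ge0// ltW.
  rewrite /W exprMn exprVn exprMn (powR_frac3 2 LD0).
  rewrite (powR_frac3 1 (ltW tR)) (powR_frac3 2 (ltW RR)).
  by rewrite expr1 !exprMn.
move: S W S0 S2 W0 W3 => S W S0 S2 W0 W3.
set A := (_ + _ + _) * _.
pose D := Delta / rounds%:R.
have D0' : 0 < D by rewrite divr_gt0.
have A1 : 0 < L / tau%:R * D by rewrite mulr_gt0// divr_gt0.
have A2 : 0 <= q * D by rewrite mulr_ge0// ltW.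
have A3 : 0 <= rho * D by rewrite mulr_ge0// ltW.
have AE : A = L / tau%:R * D + q * D + rho * D by rewrite /A !mulrDl.
have A0 : 0 < A by rewrite AE; lra.
pose B := 32 * A + S + W.
have B0 : 0 < B by rewrite /B; lra.
have BS : S <= B by rewrite /B; lra.
have BW : W <= B by rewrite /B; lra.
pose eta := Delta / (rounds%:R * tau%:R * B).
have eta0 : 0 < eta by rewrite divr_gt0// mulr_gt0// mulr_gt0.
have DE : Delta = eta * (rounds%:R * tau%:R * B).
  by rewrite /eta mulfVK// gt_eqF// mulr_gt0// mulr_gt0.
have etaE : tau%:R * eta * B = D.
  by rewrite /D DE; field; rewrite gt_eqF.
clearbody eta.
(* each coefficient of A, times tau eta, is at most 1 / 32 *)
have coef c : 0 <= c -> c * D <= A -> tau%:R * eta * c <= 32^-1.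
  move=> c0 cA; rewrite -(ler_pM2r B0).
  have -> : tau%:R * eta * c * B = c * D by rewrite -etaE; ring.
  by rewrite /B; lra.
have te0 : 0 <= tau%:R * eta by rewrite mulr_ge0 ?ltW.
exists eta; split=> //.
- have := @coef (L / tau%:R) (ltW (divr_gt0 L0 tR)).
  have -> : tau%:R * eta * (L / tau%:R) = L * eta by field; rewrite gt_eqF.
  by apply; rewrite AE; lra.
- by apply: coef => //; rewrite AE; lra.
- have h : tau%:R * eta * q <= 32^-1 by apply: coef => //; rewrite AE; lra.
  have -> : tau%:R ^+ 2 * eta ^+ 2 * (L * delta) = (tau%:R * eta * q) ^+ 2.
    by rewrite -q2; ring.
  have : (tau%:R * eta * q) ^+ 2 <= 32^-1 * 32^-1.
    by rewrite expr2; apply: ler_pM => //; rewrite mulr_ge0.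
  by lra.
have {}W3 : W ^+ 3 / B ^+ 2 = L ^+ 2 * tau%:R * eta ^+ 2 * sigma ^+ 2.
  by rewrite W3 DE; field; rewrite !gt_eqF.
have {}S2 : S ^+ 2 / B = L * eta * (sigma ^+ 2 / n%:R).
  by rewrite S2 DE; field; rewrite !gt_eqF.
have -> : 2 / (2 * rounds * tau)%N%:R * (2 / eta * Delta
     + rounds%:R * (39 * L ^+ 2 * tau%:R ^+ 2 * eta ^+ 2 * sigma ^+ 2
                    + tau%:R * L * eta * (sigma ^+ 2 / n%:R))) =
    2 * B + 39 * (W ^+ 3 / B ^+ 2) + S ^+ 2 / B.
  rewrite W3 S2 DE !natrM.
  have -> : 2 / eta * (eta * (rounds%:R * tau%:R * B)) =
    2 * (rounds%:R * tau%:R * B) by field; rewrite gt_eqF.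
  by field; rewrite !gt_eqF.
have hS : S ^+ 2 / B <= S.
  by rewrite ler_pdivrMr// expr2; apply: ler_wpM2l.
have hW : W ^+ 3 / B ^+ 2 <= W.
  rewrite ler_pdivrMr ?exprn_gt0// exprS; apply: ler_wpM2l => //.
  by rewrite ler_sqr// nnegrE// ltW.
by rewrite /B; lra.
Qed.

Theorem theorem4 (R : realType) :
  exists C : R, 0 < C /\
  forall (n tau rounds : nat) (L Delta sigma delta rho : R),
    (1 <= n)%N -> (2 <= tau)%N -> (1 <= rounds)%N ->
    0 < L -> 0 < Delta -> 0 <= sigma ->
    0 <= delta <= L -> 0 <= rho <= L ->
  let T := (2 * rounds * tau)%N in
  exists eta : R, 0 < eta /\
  forall (d : nat) (f : 'I_n -> 'rV[R]_d -> R) (x0 : 'rV[R]_d),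
    (forall i, smooth L (f i)) ->
    has_lbound (range (global_obj f)) ->
    Delta = global_obj f x0 - inf (range (global_obj f)) ->
    hessian_similarity delta f ->
    (forall i, weakly_convex rho (f i)) ->
  forall (dO dX : measure_display) (Om : measurableType dO)
    (P : probability Om R) (Xi : 'I_n -> measurableType dX)
    (G : forall i : 'I_n, 'rV[R]_d -> Xi i -> 'rV[R]_d)
    (xi : forall i : 'I_n, nat -> Om -> Xi i),
    stochastic_oracle T sigma f P G xi ->
  forall x : nat -> 'I_n -> Om -> 'rV[R]_d,
    (forall w : Om,
       scaffold tau rounds eta x0 (fun t i => x t i w)
         (fun t i => G i (x t i w) (xi i t w))) ->
  ((2 / T%:R)%R%:E *
     \sum_(0 <= r < rounds) \sum_(0 <= k < tau)
       'E_P[fun w => (norm2 (grad (global_obj f)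
              (mean (fun i => x (2 * r * tau + tau + k)%N i w))) ^+ 2)%R]
   <= (C * ((L / tau%:R + Num.sqrt (L * delta) + rho) * (Delta / rounds%:R)
            + Num.sqrt (L * Delta * sigma ^+ 2 / (n%:R * tau%:R * rounds%:R))
            + (L * Delta * sigma) `^ (2 / 3)
              / (tau%:R `^ (1 / 3) * rounds%:R `^ (2 / 3))))%R%:E)%E.
Proof.
exists 64; split=> // n tau rounds L Delta sigma delta rho n0 tau1 R0 L0 D0 s0
  dL rL T.
have t0 : (0 < tau)%N by exact: ltnW.
have [d0 _] := andP dL; have [r0 _] := andP rL.
have [eta [eta0 eL er ed bound]] := stepsize n0 t0 R0 L0 D0 s0 d0 r0.
exists eta; split=> // d f x0 fs fb DE fsim fw dO dX Om P Xi G xi so x sc.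
have key := rounds_expectation so n0 tau1 L0 fs dL rL fsim fw fb eta0 eL er ed sc.
rewrite -DE in key.
have E : (\sum_(0 <= r < rounds) \sum_(0 <= k < tau)
     'E_P[fun w => (norm2 (grad (global_obj f)
        (mean (fun i => x (2 * r * tau + tau + k)%N i w))) ^+ 2)%R] =
   (\sum_(0 <= r < rounds) \sum_(0 <= k < tau)
     Ex P (fun w => sq (grad (global_obj f)
        (mean_iterate x (2 * r * tau + tau + k)%N w))))%R%:E)%E.
  rewrite -sumEFin; apply: eq_big_nat => r /andP[_ rR].
  rewrite -sumEFin; apply: eq_big_nat => k /andP[_ kt].
  have i := integrable_grad so n0 tau1 L0 fs sc rR kt.
  rewrite -(ExE i); congr expectation; apply/funext => w.
  exact: norm2_sqr.
rewrite E -EFinM lee_fin; apply: le_trans bound.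
by apply: ler_wpM2l key; rewrite divr_ge0.
Qed.
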